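(* Let $H$ be a separable real Hilbert space, $|\cdot|$ a measurable norm on $H$, and $B$ the Banach space obtained by completing $H$ with respect to $|\cdot|$. Let $M_p=p+M_0$, where $M_0$ is a closed subspace of $H$ and $p\in M_0^\perp$. Then there is a unique Borel measure $\mu_{M_p}$ on $B$ such that $$\int_B e^{i x^*}\,d\mu_{M_p}=e^{i\langle x^*,p\rangle-\frac12\|x^*_{M_0}\|_{H^*}^2}\quad\text{for all }x^*\in B^*,$$ where $x^*_{M_0}$ denotes the element of $H^*$ given by $x^*|_{M_0}$ on $M_0$ and $0$ on $M_0^\perp$. The measure $\mu_{M_p}$ is concentrated on the closure $\overline{M_p}$ of $M_p$ in $B$.
   Context: A norm $|\cdot|$ on a real separable Hilbert space $H$ is a measurable norm if for every $\epsilon>0$ there is a finite-dimensional subspace $F_0\subset H$ such that $\mathrm{Gauss}[v\in F_1: |v|>\epsilon]<\epsilon$ for every finite-dimensional subspace $F_1\subset H$ orthogonal to $F_0$, where $\mathrm{Gauss}$ is standard Gaussian measure on $F_1$. Elements $x^*\in B^*$ are regarded as elements of $H^*$ by restriction to $H\subset B$. *)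

(* Defs.v *)
From HB Require Import structures.
From mathcomp Require Import all_boot all_order all_algebra.
From mathcomp Require Import all_classical all_reals all_analysis.
Set Implicit Arguments. Unset Strict Implicit. Unset Printing Implicit Defensive.
Import Order.TTheory GRing.Theory Num.Theory.
Import numFieldNormedType.Exports.
Local Open Scope classical_set_scope.
Local Open Scope ring_scope.

Section Defs.
Context {R : realType}.

Definition is_inner_product (H : normedModType R) (inner : H -> H -> R) : Prop :=
  [/\ forall u v, inner u v = inner v u,
      forall a u v w, inner (a *: u + v) w = a * inner u w + inner v w
    & forall u, `|u| = Num.sqrt (inner u u)].

Definition separable_Hilbert (H : completeNormedModType R) (inner : H -> H -> R) : Prop :=
  is_inner_product inner /\ exists D : set H, countable D /\ closure D = setT.

Definition orthonormal (H : normedModType R) (inner : H -> H -> R) (es : seq H) : Prop :=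
  forall i k, (i < size es)%N -> (k < size es)%N ->
    inner (nth 0 es i) (nth 0 es k) = (i == k)%:R.

(** Integral against standard Gaussian measure on span(es), es orthonormal:
    v = sum_i t_i e_i with t_i i.i.d. N(0,1) (iterated integrals). *)
Fixpoint gauss_int (H : normedModType R) (es : seq H) (f : H -> \bar R) : \bar R :=
  match es with
  | [::] => f 0
  | e :: es' =>
      integral (@lebesgue_measure R) setT
        (fun t : R => ((normal_pdf 0 1 t)%:E *
                        gauss_int es' (fun v => f (t *: e + v)%R))%E)
  end.

Definition gauss_prob (H : normedModType R) (es : seq H) (A : set H) : \bar R :=
  gauss_int es (fun v => (\1_A v)%:E).

(** measurable norm [nu] on the Hilbert space (H, inner) (Gross). The
    finite-dimensional subspace F0 is the span of a finite family fs; a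
    finite-dimensional subspace F1 orthogonal to F0 is given by an orthonormal
    basis es with each e orthogonal to each f. *)
Definition measurable_norm (H : normedModType R) (inner : H -> H -> R)
    (nu : H -> R) : Prop :=
  forall eps : R, 0 < eps ->
  exists fs : seq H, forall es : seq H, orthonormal inner es ->
    (forall i k, (i < size es)%N -> (k < size fs)%N ->
       inner (nth 0 es i) (nth 0 fs k) = 0) ->
    (gauss_prob es [set v | (eps < nu v)%R] < eps%:E)%E.

(** [j : H -> B] realises the Banach space B as the completion of H w.r.t. the
    norm v |-> |j v|: j is linear, injective, and has dense range. *)
Definition completion_embedding (H : normedModType R) (B : completeNormedModType R)
    (j : H -> B) : Prop :=
  [/\ forall a u v, j (a *: u + v) = a *: j u + j v,
      injective j
    & closure (range j) = setT].

Definition closed_subspace (H : normedModType R) (M : set H) : Prop :=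
  [/\ M 0, forall a u v, M u -> M v -> M (a *: u + v) & closed M].

Definition dual_elt (B : normedModType R) (x : B -> R) : Prop :=
  (forall a u v, x (a *: u + v) = a * x u + x v) /\ continuous x.

Definition orth_proj (H : normedModType R) (inner : H -> H -> R) (M : set H)
    (h : H) : H :=
  xget 0 [set m | M m /\ forall n, M n -> inner (h - m) n = 0].

(** the functional x*_{M0} on H: x* (restricted to H via j) on M0, 0 on M0^perp *)
Definition restr_functional (H : normedModType R) (B : normedModType R)
    (inner : H -> H -> R) (j : H -> B) (M0 : set H) (x : B -> R) : H -> R :=
  fun h => x (j (orth_proj inner M0 h)).

Definition dual_norm (H : normedModType R) (f : H -> R) : \bar R :=
  ereal_sup [set (`|f h|)%:E | h in [set h : H | `|h| <= 1]].

End Defs.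

Notation borel T := (g_sigma_algebraType (@open T)).

Section CharDefs.
Context {R : realType}.
Local Open Scope ring_scope.

(** [mu] has characteristic functional
      int_B e^{i x*} dmu = e^{i <x*,p> - ||x*_{M0}||^2_{H*}/2}  for all x* in B*,
    split into real and imaginary parts (cos / sin), including integrability. *)
Definition char_functional_prop (H : normedModType R) (B : normedModType R)
    (inner : H -> H -> R) (j : H -> B) (M0 : set H) (p : H)
    (mu : set (borel B) -> \bar R) : Prop :=
  forall x : B -> R, dual_elt x ->
    let n := dual_norm (restr_functional inner j M0 x) in
    [/\ n \is a fin_num,
        mu.-integrable setT (fun b : borel B => (cos (x b))%:E),
        mu.-integrable setT (fun b : borel B => (sin (x b))%:E),
        (\int[mu]_b (cos (x b))%:E =
           (expR (- (fine n ^+ 2 / 2)) * cos (x (j p)))%:E)%E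
      & (\int[mu]_b (sin (x b))%:E =
           (expR (- (fine n ^+ 2 / 2)) * sin (x (j p)))%:E)%E].
End CharDefs.

(* Main.v *)
Require Import Defs.
From HB Require Import structures.
From mathcomp Require Import all_boot all_order all_algebra.
From mathcomp Require Import all_classical all_reals all_analysis.
From mathcomp Require Import measurable_realfun lebesgue_integral_under ring lra.
Set Implicit Arguments. Unset Strict Implicit. Unset Printing Implicit Defensive.
Import Order.TTheory GRing.Theory Num.Theory.
Import numFieldNormedType.Exports.
Local Open Scope classical_set_scope.
Local Open Scope ring_scope.

(** Existence. Let [(e_i)] be an orthonormal basis of [M0] and [(X_i)] independent
    standard normal variables: the measure is the law of
    [j p + \sum_i X_i j(e_i)]. The basis comes from Gram-Schmidt applied to the
    projections on [M0] of a dense sequence together with the finite families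
    that the measurability of the norm provides for [eps = 2^-(k+1)]. Hence the
    vectors far out in the basis are orthogonal to the [k]-th family, the blocks
    of the series are small in probability, and by Borel-Cantelli a subsequence
    of the partial sums converges almost surely. Parseval's identity computes
    the characteristic functional of the limit. The [X_i] are built on the space
    of coin tosses, where interleaving two independent sequences preserves the
    measure; this turns expectations into the iterated integrals [gauss_int].

    Uniqueness. By Fubini and the Gaussian characteristic function, the
    characteristic functional determines the integrals of the weights
    [exp(- \sum_k (x_k - y_k)^2 / 2)], with [x_k] in the dual of [B]. Weights are
    stable under products, and polynomials in one weight converge to the
    indicator of [|x - y| > r]. By Hahn-Banach and separability, these slabs
    generate the Borel sets of [B]. *)

(** * The Gaussian characteristic function *)

(** Continuity of [j] is not among the hypotheses and is extracted from the measurability of the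
    norm. With tolerance [1/2], a Gaussian tail bound on a line orthogonal to the exceptional family
    bounds [|j e|], and restoring finitely many dimensions keeps [j] bounded. Boundedness turns
    functionals on [B] into bounded functionals on [H], and carries a dense sequence of [H] to one
    of [B]. The basis may contain zero vectors, so finite- and infinite-dimensional [M0] are treated
    alike: a zero vector adds nothing to a sum and integrates out of [gauss_int]. Cosines carry a
    free phase throughout. In inductions the phase absorbs the remaining terms of a sum, in the
    final computation it absorbs [x (j p)], and the phase [-pi/2] produces the sine. Where Tonelli
    is applied, the integrand is [1 + cos], which is nonnegative. The random series is set to [0] on
    its exceptional null set, so its values lie in the closure of [j M0] everywhere, and
    concentration needs no further limit argument. *)

Section GaussianCharacteristicFunction.
Context {R : realType}.
Local Notation leb := (@lebesgue_measure R).
Local Notation phi := (@normal_pdf R 0 1).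
Variable s : R.

Lemma std_normal_pdfE (x : R) :
  phi x = normal_peak 1 * expR (- (x ^+ 2 / 2)).
Proof.
rewrite normal_pdfE ?oner_neq0// /normal_fun subr0 expr1n mulNr.
by [].
Qed.

#[local] Instance is_derive_std_normal (x : R) :
  is_derive x 1 phi (- (x * phi x)).
Proof.
have -> : phi = (fun y => normal_peak 1 * expR (- (y ^+ 2 / 2))).
  by apply/funext => y; exact: std_normal_pdfE.
apply: is_derive_eq.
rewrite /GRing.scale/=; lra.
Qed.

#[local] Instance is_derive_cosMl (a t : R) :
  is_derive t 1 (fun t => cos (s + t * a)) (- (a * sin (s + t * a))).
Proof.
apply: is_derive_eq.
rewrite /GRing.scale/=; lra.
Qed.

#[local] Instance is_derive_sinMr (a t : R) :
  is_derive t 1 (fun t => sin (s + a * t)) (a * cos (s + a * t)).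
Proof.
apply: is_derive_eq.
rewrite /GRing.scale/=; lra.
Qed.

Lemma integrable_bounded_std_normal (h : R -> R) : measurable_fun setT h ->
  (forall x, `|h x| <= 1) ->
  leb.-integrable setT (fun x => (h x * phi x)%:E).
Proof.
move=> mh h1; apply: le_integrable (integrable_normal_pdf 0 1) => //.
  by apply/measurable_EFinP/measurable_funM => //; exact: measurable_normal_pdf.
move=> x _; rewrite /= lee_fin normrM ler_piMl//.
Qed.

(** Half of the Gaussian decay absorbs the factor: [|x| <= 2 exp(x^2/4)], so the function is at most
    a multiple of the normal density of variance 2. It is the dominating function for
    differentiating under the integral sign. *)
Lemma integrable_abs_std_normal :
  leb.-integrable setT (fun x => (`|x| * phi x)%:E).
Proof.
have s2 : Num.sqrt 2 != 0 :> R by rewrite gt_eqF// sqrtr_gt0.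
(* The 2 comes from [|x| <= 2 exp(x^2/4)]; the quotient exchanges the normalising constants of the
   two densities. *)
pose K : R := 2 * normal_peak 1 / normal_peak (Num.sqrt 2).
have pk : 0 < normal_peak (Num.sqrt 2) :> R by exact: normal_peak_gt0.
have := @integrableZl _ _ _ leb setT measurableT K _
  (integrable_normal_pdf 0 (Num.sqrt 2)).
apply: le_integrable => //.
  apply/measurable_EFinP/measurable_funM; first exact: normr_measurable.
  exact: measurable_normal_pdf.
move=> x _; rewrite /= lee_fin normrM normr_id (ger0_norm (normal_pdf_ge0 _ _ _)).
rewrite (@ger0_norm _ (K * _)); last first.
  by rewrite mulr_ge0 ?normal_pdf_ge0// /K divr_ge0 ?mulr_ge0 ?normal_peak_ge0.
rewrite std_normal_pdfE normal_pdfE// /normal_fun subr0 sqr_sqrtr//.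
rewrite (_ : - x ^+ 2 / (2 *+ 2) = - (x ^+ 2 / 2) + x ^+ 2 / 4); last first.
  by rewrite (_ : 2 *+ 2 = 4 :> R); lra.
rewrite expRD /K.
set p1 := normal_peak 1; set p2 := normal_peak _; set e := expR (- _).
rewrite (_ : 2 * p1 / p2 * _ = (2 * expR (x ^+ 2 / 4)) * (p1 * e)); last first.
  by field; rewrite gt_eqF.
apply: ler_wpM2r; first by rewrite mulr_ge0// ?normal_peak_ge0 ?expR_ge0.
have := expR_ge1Dx (x ^+ 2 / 4).
have : 0 <= (`|x| - 1) ^+ 2 by exact: sqr_ge0.
have : `|x| ^+ 2 = x ^+ 2 by rewrite real_normK// num_real.
move: (`|x|) => y; nra.
Qed.

Lemma measurable_cosM (a : R) : measurable_fun setT (fun x : R => cos (s + a * x)).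
Proof. by apply: continuous_measurable_fun; move=> x; apply: continuous_comp;
  [apply: cvgD; [exact: cvg_cst|exact: mulrl_continuous]|exact: continuous_cos]. Qed.

Lemma measurable_sinM (a : R) : measurable_fun setT (fun x : R => sin (s + a * x)).
Proof. by apply: continuous_measurable_fun; move=> x; apply: continuous_comp;
  [apply: cvgD; [exact: cvg_cst|exact: mulrl_continuous]|exact: continuous_sin]. Qed.


(** This function solves [F' = - t F]: its derivative is the integral [dF] below, which integration
    by parts turns into [- t F t]. Hence [F t * exp(t^2/2)] is constant. *)
Let F (t : R) : R := (\int[leb]_x (cos (s + t * x) * phi x))%R.

Let dF (t : R) : R := (\int[leb]_x (- (x * sin (s + t * x) * phi x)))%R.

Let partial_F t x :
  partial1of2 (fun t x : R => cos (s + t * x) * phi x) t x = - (x * sin (s + t * x) *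
    phi x).
Proof.
rewrite partial1of2E.
have : is_derive t 1 (fun t => cos (s + t * x) * phi x) (- (x * sin (s + t * x) * phi
  x)).
  apply: is_derive_eq; rewrite /GRing.scale/=; lra.
by move=> /@derive_val.
Qed.

Let integrable_cos t : leb.-integrable setT (fun x => (cos (s + t * x) * phi x)%:E).
Proof.
apply: integrable_bounded_std_normal; first exact: measurable_cosM.
by move=> x; exact: cos_max.
Qed.

Let is_derive_F (t : R) : is_derive t (1 : R) F (dF t).
Proof.
have It : [set` `]t - 1, t + 1[] t by rewrite /= in_itv/=; lra.
pose f := fun t x : R => cos (s + t * x) * phi x.
have intf : forall x, [set` `]t - 1, t + 1[] x -> leb.-integrable setT (EFin \o f x).
  by move=> x _; exact: integrable_cos.
have derf : forall x y, [set` `]t - 1, t + 1[] x -> setT y -> derivable (f ^~ y) x 1.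
  move=> x y _ _; exact: ex_derive.
have G0 (y : R) : 0 <= `|y| * phi y by rewrite mulr_ge0// normal_pdf_ge0.
have Gub : forall x y, [set` `]t - 1, t + 1[] x -> setT y ->
    `|partial1of2 f x y| <= `|y| * phi y.
  move=> x y _ _; rewrite partial_F normrN 2!normrM (ger0_norm (normal_pdf_ge0 _ _ _)).
  by rewrite ler_wpM2r ?normal_pdf_ge0// ler_piMr// sin_max.
apply: DeriveDef.
  exact: (derivable_under_integral measurableT It intf derf G0
    integrable_abs_std_normal Gub).
rewrite -derive1E.
rewrite (differentiation_under_integral measurableT It intf derf G0
  integrable_abs_std_normal Gub).
by apply: eq_Rintegral => x _; rewrite partial_F.
Qed.

(** The derivative in [x] of [sin (s + t * x) * phi x]. That its integral vanishes is the
    integration by parts. *)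
Let dh (t x : R) : R := t * cos (s + t * x) * phi x - x * sin (s + t * x) * phi x.

Let is_derive_h (t x : R) : is_derive x 1 (fun x => sin (s + t * x) * phi x) (dh t x).
Proof. by apply: is_derive_eq; rewrite /GRing.scale/= /dh; lra. Qed.

Let integrable_xsin t :
  leb.-integrable setT (fun x => (x * sin (s + t * x) * phi x)%:E).
Proof.
apply: le_integrable integrable_abs_std_normal => //.
  apply/measurable_EFinP/measurable_funM; last exact: measurable_normal_pdf.
  by apply: measurable_funM => //; exact: measurable_sinM.
move=> x _; rewrite /= lee_fin !normrM normr_id ler_wpM2r// ler_piMr// ?sin_max//.
Qed.

Let integrable_tcos t :
  leb.-integrable setT (fun x => (t * cos (s + t * x) * phi x)%:E).
Proof.
have := @integrableZl _ _ _ leb setT measurableT t _ (integrable_cos t).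
by apply: eq_integrable => // x _; rewrite /= -EFinM mulrA.
Qed.

Let integrable_dh t : leb.-integrable setT (fun x => (dh t x)%:E).
Proof.
have := integrableB measurableT (integrable_tcos t) (integrable_xsin t).
by apply: eq_integrable => // x _; rewrite /= -EFinB.
Qed.

Let cvg_std_normal : phi n%:R @[n --> \oo] --> (0 : R).
Proof.
have -> : (fun n => phi n%:R) = (fun n => normal_peak 1 * expR (- ((n%:R : R) ^+ 2 /
  2))).
  by apply/funext => n; exact: std_normal_pdfE.
rewrite -[X in _ --> X](mulr0 (normal_peak 1 : R)).
apply: cvgMr.
apply: (@squeeze_cvgr _ _ _ _ (cst 0) (fun n => 2 / n%:R : R)).
- near=> n; rewrite expR_ge0/= expRN.
  have n0 : 0 < n%:R :> R by rewrite ltr0n; near: n; exact: nbhs_infty_gt.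
  have n1 : 1 <= n%:R :> R by rewrite ler1n; near: n; exact: nbhs_infty_gt.
  rewrite -[leRHS]invrK invfM invrK lef_pV2 ?posrE ?expR_gt0//; last first.
    by rewrite mulr_gt0// invr_gt0.
  have := expR_ge1Dx ((n%:R : R) ^+ 2 / 2); nra.
- exact: cvg_cst.
- rewrite -[X in _ --> X](mulr0 (2 : R)); apply: cvgMr.
  by apply/gtr0_cvgV0; [near=> n; rewrite ltr0n; near: n;
    exact: nbhs_infty_gt|exact: cvgr_idn].
Unshelve. all: by end_near. Qed.

(** On [[-(n+1), n+1]] the fundamental theorem of calculus leaves boundary terms of size at most
    [2 phi(n+1)], which vanish in the limit; dominated convergence passes to the whole line. *)
Let integral_dh t : (\int[leb]_x (dh t x))%R = 0.
Proof.
pose h x := sin (s + t * x) * phi x.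
pose g (n : nat) (x : R) := dh t x * \1_`[- n.+1%:R, n.+1%:R] x.
have mdh : measurable_fun setT (dh t).
  by have /measurable_int/measurable_EFinP := integrable_dh t.
have cv : (\int[leb]_x (g n x)%:E)%E @[n --> \oo] --> (\int[leb]_x (dh t x)%:E)%E.
  apply: (@dominated_cvg _ _ _ leb _ _ _ _ (fun x => `|(dh t x)%:E|%E)) => //.
  - move=> n; apply/measurable_EFinP/measurable_funM => //.
  - move=> x _; apply: cvg_near_cst; near=> n; rewrite /g indicE mem_set ?mulr1//=.
    rewrite in_itv/= -ler_norml (@le_trans _ _ n%:R)// ?ler_nat//.
    by near: n; exact: nbhs_infty_ger.
  - exact: integrable_abse.
  - move=> n x _; rewrite /= lee_fin normrM ler_piMr//.
    by rewrite ger0_norm// indicE lern1 leq_b1.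
have E n : (\int[leb]_x (g n x)%:E = (h n.+1%:R - h (- n.+1%:R))%:E)%E.
  have -> : (\int[leb]_x (g n x)%:E = \int[leb]_(x in `[(- n.+1%:R)%R, n.+1%:R%R]) (dh
    t x)%:E)%E.
    rewrite [RHS]integral_mkcond; apply: eq_integral => x _.
    by rewrite /g epatch_indic EFinM.
  rewrite (@continuous_FTC2 _ _ h)//.
  - by have : 0 < n.+1%:R :> R by [rewrite ltr0n]; lra.
  - apply: continuous_subspaceT => x.
    apply: cvgB; apply: cvgM; last exact: continuous_normal_pdf.
    + apply: cvgM; first exact: cvg_cst.
      by apply: continuous_comp; [apply: cvgD;
        [exact: cvg_cst|exact: mulrl_continuous]|exact: continuous_cos].
    + exact: continuous_normal_pdf.
    + apply: cvgM; first exact: cvg_id.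
      by apply: continuous_comp; [apply: cvgD;
        [exact: cvg_cst|exact: mulrl_continuous]|exact: continuous_sin].
  - have hc x : {for x, continuous h}.
      by apply: differentiable_continuous; apply/derivable1_diffP; exact: ex_derive.
    split; first by move=> x _; exact: ex_derive.
    + by apply: cvg_at_right_filter; exact: hc.
    + by apply: cvg_at_left_filter; exact: hc.
  - by move=> x _; rewrite derive1E; have /@derive_val := is_derive_h t x.
have hb n : `|h n.+1%:R - h (- n.+1%:R)| <= phi n.+1%:R *+ 2.
  have phiN : phi (- n.+1%:R) = phi n.+1%:R by rewrite !std_normal_pdfE sqrrN.
  rewrite (le_trans (ler_normB _ _))// mulr2n lerD//.
    by rewrite normrM (ger0_norm (normal_pdf_ge0 _ _ _)) ler_piMl ?normal_pdf_ge0//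
      sin_max.
  by rewrite normrM phiN (ger0_norm (normal_pdf_ge0 _ _ _)) ler_piMl ?normal_pdf_ge0//
    sin_max.
have h0 : h n.+1%:R - h (- n.+1%:R) @[n --> \oo] --> (0 : R).
  apply/norm_cvg0P.
  apply: (@squeeze_cvgr _ _ _ _ (cst 0) (fun n => phi n.+1%:R *+ 2)).
  - by near=> n; rewrite normr_ge0 hb.
  - exact: cvg_cst.
  - rewrite -[X in _ --> X](mul0rn _ 2); apply: cvgMn.
    by rewrite (cvg_shiftS (fun n => phi n%:R)).
move: cv; under eq_fun do rewrite E.
rewrite /Rintegral => cv.
have h0' : (h n.+1%:R - h (- n.+1%:R))%:E @[n --> \oo] --> 0%:E.
  by apply: cvg_EFin => //; exact: nearW.
by have -> := cvg_unique (@ereal_hausdorff R) cv h0'.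
Unshelve. all: by end_near. Qed.

Let FE t : F t = expR (- (t ^+ 2 / 2)) * cos s.
Proof.
have dFE u : dF u = - (u * F u).
  have h1 : \int[leb]_x (u * cos (s + u * x) * phi x) = u * F u.
    rewrite /F -RintegralZl//; last exact: integrable_cos.
    by apply: eq_Rintegral => x _; rewrite mulrA.
  have h2 : dF u = - \int[leb]_x (x * sin (s + u * x) * phi x).
    rewrite /dF -mulN1r -RintegralZl//; last exact: integrable_xsin.
    by apply: eq_Rintegral => x _; rewrite mulN1r.
  have := integral_dh u.
  rewrite (RintegralB measurableT (integrable_tcos u) (integrable_xsin u)).
  by move=> /subr0_eq h3; rewrite h2 -h3 h1.
pose G u := F u * expR (u ^+ 2 / 2).
have G' u : is_derive u (1 : R) G 0.
  have dFu := is_derive_F u.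
  apply: is_derive_eq; rewrite /GRing.scale/= dFE; lra.
have : G t = G 0 by exact: is_derive_0_is_cst.
rewrite /G expr0n mul0r expR0 mulr1.
have -> : F 0 = cos s.
  rewrite /F; under eq_Rintegral do rewrite mul0r addr0.
  rewrite RintegralZl//; last exact: integrable_normal_pdf.
  by rewrite /Rintegral integral_normal_pdf mulr1.
by move=> <-; rewrite expRN mulrC mulfK// gt_eqF// expR_gt0.
Qed.

Lemma integrable_std_normal_cos (a : R) :
  leb.-integrable setT (fun x => (phi x * cos (s + a * x))%:E).
Proof. by under eq_fun do rewrite mulrC; exact: integrable_cos. Qed.

Lemma integral_std_normal_cos (a : R) :
  (\int[leb]_x (phi x * cos (s + a * x))%:E = (expR (- (a ^+ 2 / 2)) * cos s)%:E)%E.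
Proof.
rewrite -FE /F /Rintegral fineK; last exact: integrable_fin_num.
by apply: eq_integral => x _; rewrite mulrC.
Qed.

End GaussianCharacteristicFunction.

(** * Independent normal variables on the space of coin tosses *)

Section CoinSpace.

Definition word_cyl (w : seq bool) : set (nat -> bool) :=
  [set om | forall i, (i < size w)%N -> om i = nth false w i].

(* Only words of even length, so that a cylinder splits evenly under [ileave]. *)
Definition coin_gen : set (set (nat -> bool)) :=
  [set A | A = set0 \/ exists2 w, ~~ odd (size w) & A = word_cyl w].

Definition coins := g_sigma_algebraType coin_gen.
HB.instance Definition _ := Measurable.on coins.

(** Two cylinders are disjoint or nested: if they meet, the shorter word is a prefix of the longer
    one. *)
Lemma coin_gen_setI : setI_closed coin_gen.
Proof.
have aux w w' : (size w <= size w')%N -> ~~ odd (size w') ->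
    coin_gen (word_cyl w `&` word_cyl w').
  move=> ww ow'; have [->|/set0P[om [omw omw']]] := eqVneq (word_cyl w `&` word_cyl w')
    set0.
    by left.
  right; exists w' => //; apply/seteqP; split; first by move=> ? [].
  move=> om' om'w'; split => // i iw.
  by rewrite om'w' ?(leq_trans iw)// -omw' ?(leq_trans iw)// omw.
move=> A A' [->|[w ow ->]]; first by rewrite set0I; left.
move=> [->|[w' ow' ->]]; first by rewrite setI0; left.
have [ww|/ltnW ww] := leqP (size w) (size w'); first exact: aux.
by rewrite setIC; exact: aux.
Qed.

Lemma measurable_coin i : measurable_fun setT (fun om : coins => om i).
Proof.
apply: (measurable_fun_bool true); rewrite setTI.
have -> : (fun om : coins => om i) @^-1` [set true] =
    \bigcup_(w : seq bool)
      (if [&& ~~ odd (size w), (i < size w)%N & nth false w i]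
       then word_cyl w else set0).
  apply/seteqP; split => om /=.
    (* The first [2(i+1)] tosses form a word of even length that reaches index [i]. *)
    move=> omi; exists (mkseq om i.+1.*2) => //.
    have ii : (i < i.+1.*2)%N by rewrite -addnn addSn ltnS leq_addr.
    rewrite size_mkseq odd_double ii nth_mkseq// omi /= => k.
    by rewrite size_mkseq => ki; rewrite nth_mkseq.
  move=> [w _]; case: ifP => // /and3P[ow iw wi] omw.
  by rewrite omw.
apply: countable_bigcupT_measurable => // w.
case: ifP => // /and3P[ow _ _]; apply: sub_sigma_algebra.
by right; exists w.
Qed.

Lemma measurable_word_cyl w : measurable (word_cyl w : set coins).
Proof.
have -> : word_cyl w = \bigcap_i (if (i < size w)%N
    then (fun om : coins => om i) @^-1` [set nth false w i] else setT).
  apply/seteqP; split => om h.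
    by move=> i _; case: ifP => // iw /=; exact: h.
  by move=> i iw; have := h i I; rewrite iw.
apply: bigcapT_measurable => i; case: ifP => // _.
by rewrite -[X in measurable X]setTI; exact: measurable_coin.
Qed.

Lemma measurable_fun_coins d (T : measurableType d) (f : T -> coins) :
  (forall i, measurable_fun setT (fun t => f t i)) -> measurable_fun setT f.
Proof.
move=> mf; apply: (@measurability _ _ T coins setT f coin_gen erefl) => _ [A GA <-].
rewrite setTI; case: GA => [->|[w _ ->]]; first by rewrite preimage_set0.
have -> : f @^-1` word_cyl w = \bigcap_i (if (i < size w)%N
    then (fun t => f t i) @^-1` [set nth false w i] else setT).
  apply/seteqP; split => t h.
    by move=> i _; case: ifP => // iw /=; exact: h.
  by move=> i iw; have := h i I; rewrite iw.
apply: bigcapT_measurable => i; case: ifP => // _.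
by rewrite -[X in measurable X]setTI; exact: mf.
Qed.

Definition evens (om : coins) : coins := fun n => om n.*2.
Definition odds (om : coins) : coins := fun n => om n.*2.+1.
Definition ileave (ab : coins * coins) : coins :=
  fun n => if odd n then ab.2 n./2 else ab.1 n./2.

Lemma evens_ileave ab : evens (ileave ab) = ab.1.
Proof. by apply/funext => n; rewrite /evens /ileave odd_double doubleK. Qed.

Lemma odds_ileave ab : odds (ileave ab) = ab.2.
Proof. by apply/funext => n; rewrite /odds /ileave/= odd_double uphalf_double. Qed.

Lemma measurable_evens : measurable_fun setT evens.
Proof. by apply: measurable_fun_coins => i; exact: measurable_coin. Qed.

Lemma measurable_odds : measurable_fun setT odds.
Proof. by apply: measurable_fun_coins => i; exact: measurable_coin. Qed.

Lemma measurable_ileave : measurable_fun setT ileave.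
Proof.
apply: measurable_fun_coins => i; rewrite /ileave; case: (odd i).
  by apply: (measurableT_comp (measurable_coin _)).
by apply: (measurableT_comp (measurable_coin _)).
Qed.

Lemma preimage_ileave_word_cyl w : ~~ odd (size w) ->
  ileave @^-1` word_cyl w =
  word_cyl (mkseq (fun i => nth false w i.*2) (size w)./2) `*`
  word_cyl (mkseq (fun i => nth false w i.*2.+1) (size w)./2).
Proof.
move=> ow; have sw : size w = (size w)./2.*2 by rewrite even_halfK.
have lt2 i : (i < (size w)./2)%N -> (i.*2.+1 < size w)%N.
  by move=> i2; rewrite [ltnRHS]sw -doubleS leq_double.
apply/seteqP; split => -[a b] /=.
  move=> h; split => i; rewrite size_mkseq => iw; rewrite nth_mkseq//.
    rewrite -h; last exact: ltnW (lt2 _ iw).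
    by rewrite /ileave odd_double doubleK.
  by rewrite -h ?lt2// /ileave/= odd_double uphalf_double.
move=> [ha hb] i iw; rewrite /ileave/=.
have iw2 : (i./2 < (size w)./2)%N by rewrite -ltn_double -sw (leq_ltn_trans _ iw)//
  -[leqRHS]odd_double_half leq_addl.
case: ifP => oi.
  rewrite hb ?size_mkseq// nth_mkseq//; congr nth.
  by rewrite -[RHS]odd_double_half oi.
rewrite ha ?size_mkseq// nth_mkseq//; congr nth.
by rewrite -[RHS]odd_double_half oi.
Qed.

End CoinSpace.

(** * The fair-coin measure as the law of binary digits *)

Section CoinMeasure.
Context {R : realType}.
Local Notation leb := (@lebesgue_measure R).

(** On [[0, 1[] this is [2u mod 1], the shift on binary expansions. *)
Definition doubling (u : R) : R := 2 * u - \1_`[2^-1, +oo[ u.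

Definition digits (u : R) : coins := fun n => 2^-1 <= iter n doubling u.

(** The dyadic rational with binary expansion [0.w]. *)
Fixpoint word_val (w : seq bool) : R :=
  if w is b :: w' then (b%:R + word_val w') / 2 else 0.

Lemma measurable_digits : measurable_fun setT digits.
Proof.
have md : measurable_fun setT doubling.
  by apply: measurable_funB; [exact: mulrl_measurable|exact: measurable_indic].
have mi n : measurable_fun setT (iter n doubling).
  elim: n => [|n IH]; first exact: measurable_id.
  by rewrite (_ : iter n.+1 doubling = doubling \o iter n doubling)//;
    exact: measurableT_comp.
apply: measurable_fun_coins => i; apply: (measurable_fun_bool true).
rewrite setTI (_ : _ @^-1` _ = iter i doubling @^-1` `[2^-1, +oo[); last first.
  by apply/seteqP; split => u; rewrite /digits/= in_itv/= andbT.
by rewrite -[X in measurable X]setTI; exact: mi.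
Qed.

Lemma word_val_ge0 w : 0 <= word_val w.
Proof. by elim: w => //= b w IH; rewrite divr_ge0// addr_ge0. Qed.

Lemma word_val_le w : word_val w + 2^-1 ^+ size w <= 1.
Proof.
elim: w => [|b w IH] /=; first by rewrite expr0 add0r.
rewrite exprS; have : b%:R <= 1 :> R by rewrite lern1 leq_b1.
by move: IH; lra.
Qed.

(** The digits of [doubling u] are those of [u] shifted by one, so induction on the word halves the
    dyadic interval at each letter. *)
Lemma word_cyl_digits w (u : R) : 0 <= u < 1 ->
  word_cyl w (digits u) <-> word_val w <= u < word_val w + 2^-1 ^+ size w.
Proof.
elim: w u => [|b w IH] u u01; first by split=> [_|_ i//]; rewrite /= expr0 add0r.
have du : digits (doubling u) = (fun n => digits u n.+1).
  by apply/funext => n; rewrite /digits iterSr.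
have cylS : word_cyl (b :: w) (digits u) <->
    (2^-1 <= u) = b /\ word_cyl w (digits (doubling u)).
  rewrite du; split => [h|[h0 h] [|i]//=].
    by split; [exact: (h 0%N)|move=> i iw; exact: (h i.+1)].
  by rewrite ltnS => /h.
have dE : doubling u = 2 * u - (2^-1 <= u)%R%:R.
  rewrite /doubling indicE/=; congr (_ - (nat_of_bool _)%:R).
  by apply/idP/idP; rewrite inE/= in_itv/= andbT.
rewrite cylS /= exprS dE.
have h0 := word_val_ge0 w; have h1 := word_val_le w.
move: u01 => /andP[u0 u1].
have e0 : 0 < 2^-1 ^+ size w :> R by rewrite exprn_gt0.
split.
  move=> [<-]; set c : R := (2^-1 <= u)%R%:R => h.
  have d01 : 0 <= 2 * u - c < 1.
    by rewrite /c; have [uh|uh] := leP 2^-1 u; apply/andP; split => /=; lra.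
  by move: ((IH _ d01).1 h) => /andP[h2 h3]; apply/andP; split; lra.
move=> /andP[h2 h3].
have ub : (2^-1 <= u) = b.
  case: b {IH cylS} h2 h3 => /= h2 h3; first by apply/idP; lra.
  by apply/negbTE; rewrite -ltNge; lra.
rewrite ub; split => //; apply/IH.
  by case: b {IH cylS ub} h2 h3 => /= h2 h3; apply/andP; split; lra.
by apply/andP; split; lra.
Qed.

(** The image of Lebesgue measure on [[0, 1[] under binary digits. A word of length [n] gets mass
    [2^-n], so this is the infinite product of fair coins. *)
Definition coin_measure : set coins -> \bar R :=
  pushforward (mrestr leb (measurable_itv `[0, 1[)) digits.

#[local] Definition coin_measure_canonical : {measure set coins -> \bar R} :=
  measure_function_pushforward__canonical__measure_function_Measure
    (mrestr leb (measurable_itv `[0, 1[)) measurable_digits.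

HB.instance Definition _ := Measure.copy coin_measure coin_measure_canonical.

Lemma coin_measure_word_cyl w :
  coin_measure (word_cyl w) = (2^-1 ^+ size w)%:E.
Proof.
rewrite /coin_measure /pushforward /mrestr.
have -> : digits @^-1` word_cyl w `&` `[0, 1[ =
    `[word_val w, word_val w + 2^-1 ^+ size w[%classic.
  have h0 := word_val_ge0 w; have h1 := word_val_le w.
  apply/seteqP; split => u /=; rewrite !in_itv/=.
    by move=> [cu u01]; exact/word_cyl_digits.
  move=> h; have u01 : 0 <= u < 1 by move/andP: h => [h2 h3]; apply/andP; split; lra.
  by split => //; exact/word_cyl_digits.
rewrite lebesgue_measure_itv/= lte_fin ltrDl exprn_gt0//.
by rewrite -EFinB addrAC subrr add0r.
Qed.

Lemma coin_measure_setT : coin_measure setT = 1%E.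
Proof.
rewrite (_ : setT = word_cyl [::]) ?coin_measure_word_cyl//.
by apply/seteqP; split => // om _ i.
Qed.

HB.instance Definition _ :=
  @Measure_isProbability.Build _ _ R coin_measure coin_measure_setT.

(** On a cylinder of even length [2n] both sides are [2^-n * 2^-n]; the generating cylinders are
    stable under intersection, so the two measures coincide. *)
Lemma coin_measure_ileave (A : set coins) : measurable A ->
  (coin_measure \x coin_measure)%E (ileave @^-1` A) = coin_measure A.
Proof.
move=> mA.
pose m := measure_function_pushforward__canonical__measure_function_Measure
  (coin_measure \x coin_measure)%E measurable_ileave.
apply/esym; apply: (@measure_unique _ R coins coin_gen (fun=> setT) erefl coin_gen_setI
  _ _
  coin_measure m) => //.
- by move=> _; right; exists [::] => //; apply/seteqP; split => // om _ i.
- by apply/seteqP; split => // om _; exists 0%N.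
- move=> _ [->|[w ow ->]]; first by rewrite !measure0.
  rewrite /= /pushforward preimage_ileave_word_cyl// product_measure1E//=;
    [|exact: measurable_word_cyl|exact: measurable_word_cyl].
  rewrite !coin_measure_word_cyl -EFinM -exprD !size_mkseq addnn even_halfK//.
- by move=> _; rewrite /= coin_measure_setT ltry.
Qed.

(** A left inverse of [digits] on [[0, 1[]. The upper limit is defined at every sequence and
    measurable without a discussion of convergence. *)
Definition coin_val (om : coins) : R := limn_sup (fun n => word_val (mkseq om n)).

Lemma measurable_coin_val : measurable_fun setT coin_val.
Proof.
apply: (@measurable_fun_limn_sup _ coins R setT (fun n (om : coins) => word_val (mkseq
  om n))).
- move=> om _; exists 1 => _ [n _ <-]; rewrite (le_trans _ (word_val_le (mkseq om
  n)))//.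
  by rewrite lerDl exprn_ge0.
- by move=> om _; exists 0 => _ [n _ <-]; exact: word_val_ge0.
- elim => [|n IH]; first exact: measurable_cst.
  pose sh (om : coins) : coins := fun i => om i.+1.
  have msh : measurable_fun setT sh.
    by apply: measurable_fun_coins => i; exact: measurable_coin.
  rewrite (_ : (fun om => _) =
    (fun om : coins => ((om 0%N)%:R + word_val (mkseq (sh om) n)) / 2)); last first.
    apply/funext => om; rewrite /mkseq /= /sh; congr ((_ + word_val _) / _).
    by rewrite -[1%N]addn0 iotaDl -map_comp.
  apply: measurable_funM => //; apply: measurable_funD.
    have mb : measurable_fun setT (fun b : bool => b%:R : R) by [].
    exact: (measurableT_comp mb (measurable_coin 0)).
  exact: (measurableT_comp IH msh).
Qed.

Lemma coin_valK u : 0 <= u < 1 -> coin_val (digits u) = u.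
Proof.
move=> u01; rewrite /coin_val.
have h n : word_val (mkseq (digits u) n) <= u < word_val (mkseq (digits u) n) + 2^-1 ^+
  n.
  rewrite -[X in _ ^+ X](size_mkseq (digits u)); apply/word_cyl_digits => // i.
  by rewrite size_mkseq => iw; rewrite nth_mkseq.
have cv : word_val (mkseq (digits u) n) @[n --> \oo] --> u.
  apply: (@squeeze_cvgr _ _ _ _ (fun n => u - 2^-1 ^+ n) (cst u)).
  - by near=> n; move: (h n) => /andP[h1 h2]; apply/andP; split => //; lra.
  - rewrite -[X in _ --> X]subr0; apply: cvgB; first exact: cvg_cst.
    by apply: cvg_expr; rewrite ger0_norm//; lra.
  - exact: cvg_cst.
by rewrite (cvg_limn_inf_sup cv).
Unshelve. all: by end_near. Qed.

End CoinMeasure.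

(** * Normal variables by inversion of the distribution function *)

Section Quantile.
Context {R : realType}.
Local Notation leb := (@lebesgue_measure R).
Local Notation gamma := (@normal_prob R 0 1).

Let F (x : R) : R := fine (gamma `]-oo, x]).

Let FE x : gamma `]-oo, x] = (F x)%:E.
Proof. by rewrite /F fineK// fin_num_measure. Qed.

Let F01 x : 0 <= F x <= 1.
Proof. by rewrite -!lee_fin -FE measure_ge0 probability_le1. Qed.

Let F_nd x y : x <= y -> F x <= F y.
Proof.
by move=> xy; rewrite -lee_fin -!FE le_measure ?inE//; exact: subset_itvl.
Qed.

Let idR : measurableTypeR R -> R := idfun.
#[local] HB.instance Definition _ :=
  @isMeasurableFun.Build _ _ _ _ idR (@measurable_id _ _ setT).

(** The generalised inverse of the normal distribution function. The value [0] outside []0, 1[]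
    matters only at [u = 0], a null set for the uniform law on [[0, 1[]. *)
Definition quantile (u : R) : R :=
  if 0 < u < 1 then inf [set x | u <= F x] else 0.

(** The strict inequality from right to left uses right continuity: [F] stays below [u] a little
    beyond [x], which pushes the infimum to at least [x + e/2]. *)
Let quantile_ge u x : 0 < u < 1 -> (x < quantile u) = (F x < u).
Proof.
move=> u01; rewrite /quantile u01; move/andP: u01 => [u0 u1].
set S := [set y | u <= F y].
have Fy : F @ +oo --> (1 : R).
  by apply/fine_cvg; exact: (@cvg_cdfy1 _ _ _ _ (idR : {RV gamma >-> R})).
have FNy : F @ -oo --> (0 : R).
  by apply/fine_cvg; exact: (@cvg_cdfNy0 _ _ _ _ (idR : {RV gamma >-> R})).
have S0 : S !=set0.
  have : \forall y \near +oo, u < F y by exact: (cvgr_gt _ Fy).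
  by move=> /filter_ex[y uy]; exists y; exact: ltW.
have Slb : has_lbound S.
  have : \forall y \near -oo, F y < u by exact: (cvgr_lt _ FNy).
  move=> /filter_ex[y uy]; exists y => z; rewrite /S/= => uz.
  by rewrite leNgt; apply/negP => /ltW/F_nd; lra.
apply/idP/idP.
  by move=> h; rewrite ltNge; apply/negP => /(ge_inf Slb); lra.
move=> Fxu.
have : \forall y \near x^'+, F y < u.
  have /cvgr_lt : F @ x^'+ --> F x.
    apply/fine_cvg; rewrite fineK ?fin_num_measure//.
    exact: (@cdf_right_continuous _ _ _ _ (idR : {RV gamma >-> R})).
  exact.
move=> [e /= e0 he].
apply: (@lt_le_trans _ _ (x + e / 2)); first by lra.
apply: lb_le_inf => // z; rewrite /S/= => uz; rewrite leNgt; apply/negP => /ltW/F_nd.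
have : F (x + e / 2) < u.
  apply: he => /=; last by lra.
  by rewrite opprD addrA subrr add0r normrN ger0_norm; lra.
lra.
Qed.

Lemma measurable_quantile : measurable_fun setT quantile.
Proof.
apply: (measurability _ (RGenOInfty.measurableE R)) => _ [_ [x ->] <-].
rewrite setTI.
have -> : quantile @^-1` `]x, +oo[ =
    (`]0, 1[ `&` `]F x, +oo[) `|` (~` `]0, 1[ `&` [set _ | x < 0]).
  apply/seteqP; split => u /=; rewrite !in_itv/= !andbT.
    have [u01|u01] := boolP (0 < u < 1); first by rewrite quantile_ge//; left.
    by rewrite /quantile (negbTE u01); right.
  move=> [[u01 h]|[/negP/negbTE u01 h]]; first by rewrite quantile_ge.
  by rewrite /quantile u01.
apply: measurableU; first exact: measurableI.
apply: measurableI; first exact: measurableC.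
case: (x < 0); first by rewrite (_ : [set _ | _] = setT)//; apply/seteqP; split.
by rewrite (_ : [set _ | _] = set0)//; apply/seteqP; split.
Qed.

Definition coin_normal (om : coins) : R := quantile (coin_val om).

Lemma measurable_coin_normal : measurable_fun setT coin_normal.
Proof. exact: measurableT_comp measurable_quantile measurable_coin_val. Qed.

Lemma coin_normal_law (A : set R) : measurable A ->
  coin_measure (coin_normal @^-1` A) = gamma A.
Proof.
move=> mA.
have mN : measurable_fun setT (coin_normal : coins -> measurableTypeR R).
  exact: measurable_coin_normal.
pose m := measure_function_pushforward__canonical__measure_function_Measure
  (@coin_measure R) mN.
apply/esym; rewrite -[RHS]/(m A).
refine (@measure_unique _ R (measurableTypeR R) (@RGenOInfty.G R) (fun n => `]- n%:R,
  +oo[%classic)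
  (RGenOInfty.measurableE R) _ _ _ gamma m _ _ A mA).
- move=> _ _ [x ->] [y ->]; exists (Num.max x y); apply/seteqP.
  by split => z /=; rewrite !in_itv/= !andbT gt_max => /andP.
- by move=> n; exists (- n%:R).
- apply/seteqP; split => // x _; exists (Num.truncn `|x|).+1 => //=.
  rewrite in_itv/= andbT ltrNl (le_lt_trans (ler_norm _))// normrN.
  exact: truncnS_gt.
- move=> _ [x ->]; rewrite /= /pushforward /coin_measure /pushforward /mrestr.
  move: (F01 x) => /andP[F0 F1].
  (* The endpoint [u = 0], where [quantile] takes its default value [0], belongs to the preimage
     exactly when [x < 0]. *)
  have -> : digits @^-1` (coin_normal @^-1` `]x, +oo[) `&` `[0, 1[ =
    (if x < 0 then [set 0] else set0) `|` `](F x), 1[.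
    apply/seteqP; split => u /=; rewrite !in_itv/= ?andbT.
      move=> [xu u01]; move: xu; rewrite /coin_normal coin_valK//.
      move: u01 => /andP[]; rewrite le_eqVlt => /predU1P[<- _|u0 u1].
        by rewrite /quantile ltxx/= => ->; left.
      by rewrite quantile_ge ?u0// u1 andbT; right.
    move=> [|/andP[Fu u1]].
      by case: ifP => // x0 ->; rewrite lexx ltr01 /coin_normal coin_valK ?lexx
        ?ltr01// /quantile ltxx.
    have u0 : 0 < u by lra.
    by rewrite (ltW u0) u1 /coin_normal coin_valK ?(ltW u0)// quantile_ge ?u0.
  have -> : gamma `]x, +oo[ = (1 - F x)%:E.
    by rewrite -setCitvl probability_setC// EFinB -FE.
  have lI : leb `]F x, 1[%classic = (1 - F x)%:E.
    rewrite lebesgue_measure_itv/= lte_fin; case: ltP => // h.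
    by rewrite (_ : F x = 1) ?subrr//; lra.
  case: ifP => x0; last by rewrite set0U lI.
  rewrite measureU//= ?lebesgue_measure_set1 ?add0e ?lI//.
  by apply/seteqP; split => // u /= [->]; rewrite in_itv/= ltNge F0.
- by move=> n; rewrite ltey_eq fin_num_measure.
Qed.

Import HBNNSimple.

(** For a simple function this is the definition of [normal_prob] on each level set; monotone
    convergence along simple approximations gives the rest. *)
Lemma ge0_integral_std_normal (f : R -> \bar R) : measurable_fun setT f ->
  (forall x, 0 <= f x)%E ->
  (\int[gamma]_x f x = \int[leb]_x ((normal_pdf 0 1 x)%:E * f x))%E.
Proof.
move=> mf f0.
have mf' : measurable_fun (setT : set (measurableTypeR R)) f by [].
pose f_ := nnsfun_approx measurableT mf'.
have mpdf : measurable_fun setT (fun x : R => (normal_pdf 0 1 x)%:E).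
  by apply/measurable_EFinP; exact: measurable_normal_pdf.
have pdf0 (x : R) : (0 <= (normal_pdf 0 1 x)%:E)%E by rewrite lee_fin normal_pdf_ge0.
have E (h : {nnsfun measurableTypeR R >-> R}) :
    (\int[gamma]_x (h x)%:E = \int[leb]_x ((normal_pdf 0 1 x)%:E * (h x)%:E))%E.
  under eq_integral do rewrite fimfunE -fsumEFin//.
  rewrite ge0_integral_fsum//; last 2 first.
    - by move=> r; apply/measurable_EFinP; exact: measurableT_comp.
    - by move=> r x _; rewrite EFinM nnfun_muleindic_ge0.
  under [RHS]eq_integral.
    move=> x _; rewrite fimfunE -fsumEFin// ge0_mule_fsumr; last first.
      by move=> r; rewrite EFinM nnfun_muleindic_ge0.
    over.
  rewrite [RHS]ge0_integral_fsum//; last 2 first.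
    - move=> r; apply: emeasurable_funM => //; apply/measurable_EFinP.
      exact: measurableT_comp.
    - by move=> r x _; rewrite mule_ge0// EFinM nnfun_muleindic_ge0.
  apply: eq_fsbigr => r _.
  under [RHS]eq_integral do rewrite EFinM muleCA.
  rewrite integralZl_indic_nnsfun// integral_indic// setIT.
  rewrite integralZl//; last first.
    apply: le_integrable (integrable_normal_pdf 0 1) => //.
      by apply: emeasurable_funM => //; apply/measurable_EFinP; exact: measurable_indic.
    move=> x _; rewrite -EFinM /= lee_fin normrM ler_piMr//.
    by rewrite ger0_norm// indicE lern1 leq_b1.
  congr (_ * _)%E; rewrite /= /normal_prob integral_mkcond; apply: eq_integral => x _.
  by rewrite epatch_indic.
transitivity (limn (fun n => \int[gamma]_x (f_ n x)%:E))%E.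
  rewrite -monotone_convergence//=.
  - apply: eq_integral => x _; apply/esym/cvg_lim => //.
    exact: cvg_nnsfun_approx.
  - by move=> n; apply/measurable_EFinP.
  - by move=> n x _; rewrite lee_fin.
  - by move=> x _ a b ab; rewrite lee_fin//; exact/lefP/nd_nnsfun_approx.
transitivity (limn (fun n => \int[leb]_x ((normal_pdf 0 1 x)%:E * (f_ n x)%:E)))%E.
  by congr (limn _); apply/funext => n; exact: E.
rewrite -monotone_convergence//=.
- apply: eq_integral => x _; apply: cvg_lim => //; apply: cvgeZl => //.
  exact: cvg_nnsfun_approx.
- by move=> n; apply: emeasurable_funM => //; apply/measurable_EFinP.
- by move=> n x _; rewrite mule_ge0// lee_fin.
- by move=> x _ a b ab; rewrite lee_wpmul2l// lee_fin//; exact/lefP/nd_nnsfun_approx.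
Qed.

End Quantile.

(** * Borel sets and continuous functionals *)

Section HahnBanach.
Context {R : realType} {V : normedModType R}.

(** A partial linear functional encoded by its graph, so that chains have unions. Domination by the
    norm makes the graph single-valued: two values at one vector differ by a value at [0], and so
    does their opposite. *)
Definition dominated_graph (F : set (V * R)) : Prop :=
  (forall a u v r s, F (u, r) -> F (v, s) -> F (a *: u + v, a * r + s)) /\
  (forall u r, F (u, r) -> r <= `|u|).

(** The new value [c] at [v] must lie between all [r - |u - v|] and all [|w + v| - s], for [(u, r)]
    and [(w, s)] in the graph. The triangle inequality separates the two families, and [c] is the
    supremum of the first. Scaling by [|a|^-1] reduces a general coefficient [a] to these bounds. *)
Lemma dominated_graph_extend (F : set (V * R)) (v : V) :
  dominated_graph F -> F !=set0 ->
  exists c, dominated_graph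
    [set z | exists u r a, F (u, r) /\ z = (u + a *: v, r + a * c)].
Proof.
move=> [Flin Fle] [[u0 r0] Fu0].
have F00 : F (0, 0).
  have := Flin (-1) _ _ _ _ Fu0 Fu0.
  by rewrite scaleN1r addNr mulN1r addNr.
have FZ a u r : F (u, r) -> F (a *: u, a * r).
  by move=> Fu; have := Flin a _ _ _ _ Fu F00; rewrite !addr0.
have FB u r w s : F (u, r) -> F (w, s) -> F (w - u, s - r).
  by move=> Fu Fw; have := Flin (-1) _ _ _ _ Fu Fw;
    rewrite scaleN1r mulN1r ![- _ + _]addrC.
pose L := [set s | exists u r, F (u, r) /\ s = r - `|u - v|].
have Lub u r : F (u, r) -> ubound L (`|u + v| - r).
  move=> Fu _ [w [s [Fw ->]]].
  have := Fle _ _ (Flin 1 _ _ _ _ Fu Fw); rewrite scale1r mul1r => h.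
  have := ler_normD (u + v) (w - v).
  have -> : u + v + (w - v) = u + w by rewrite addrACA subrr addr0.
  by move=> h'; lra.
have supL : has_sup L.
  split; first by exists (0 - `|0 - v|), 0, 0.
  by exists (`|0 + v| - 0); exact: Lub.
pose c := sup L.
have c1 u r : F (u, r) -> r - `|u - v| <= c.
  by move=> Fu; apply: (ub_le_sup supL.2); exists u, r.
have c2 u r : F (u, r) -> c <= `|u + v| - r.
  by move=> Fu; apply: ge_sup; [exact: supL.1|exact: Lub].
exists c; split.
  move=> a _ _ _ _ [u [r [b [Fu [-> ->]]]]] [w [s [b' [Fw [-> ->]]]]].
  exists (a *: u + w), (a * r + s), (a * b + b'); split; first exact: Flin.
  congr pair; last by lra.
  by rewrite scalerDr scalerDl scalerA addrACA.
move=> _ _ [u [r [a [Fu [-> ->]]]]].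
have [a0|a0|->] := ltgtP a 0; last by rewrite scale0r mul0r !addr0; exact: Fle.
- have := c1 _ _ (FZ (- a^-1) _ _ Fu).
  have -> : - a^-1 *: u - v = - a^-1 *: (u + a *: v).
    by rewrite scalerDr scalerA mulNr mulVf ?lt_eqF// scaleN1r.
  rewrite normrZ normrN normfV ltr0_norm//.
  set n := `|_|; move=> h.
  have a' : 0 < - a by rewrite oppr_gt0.
  have : (- a) * (- a^-1 * r - (- a)^-1 * n) <= (- a) * c by rewrite ler_pM2l.
  rewrite (_ : - a * (- a^-1 * r - (- a)^-1 * n) = r - n); first by lra.
  by field; rewrite lt_eqF.
- have := c2 _ _ (FZ a^-1 _ _ Fu).
  have -> : a^-1 *: u + v = a^-1 *: (u + a *: v).
    by rewrite scalerDr scalerA mulVf ?gt_eqF// scale1r.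
  rewrite normrZ normfV gtr0_norm//.
  set n := `|_|; move=> h.
  have : a * c <= a * (a^-1 * n - a^-1 * r) by rewrite ler_pM2l.
  rewrite (_ : a * (_ - _) = n - r); first by lra.
  by field; rewrite gt_eqF.
Qed.

Lemma norming_functional (b : V) :
  exists f : V -> R, [/\ forall a u v, f (a *: u + v) = a * f u + f v,
    forall u, f u <= `|u| & f b = `|b|].
Proof.
(* The second clause is conditional because Zorn's lemma also takes the union of the empty chain. A
   maximal [F] is then nonempty, since the line through [(b, |b|)] extends the empty graph. *)
pose P (F : set (V * R)) := dominated_graph F /\ (F !=set0 -> F (b, `|b|)).
have [|F [[[Flin Fle] Fb] Fmax]] := @Zorn_bigcup _ P.
  move=> S SP Stot; split; last first.
    by move=> [z [F SF Fz]]; exists F => //; apply: (SP _ SF).2; exists z.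
  split; last by move=> u r [F SF]; exact: (SP _ SF).1.2.
  move=> a u v r s [F SF Fu] [G SG Gv].
  have [FG|GF] := Stot _ _ SF SG.
    by exists G => //; apply: (SP _ SG).1.1 => //; exact: FG.
  by exists F => //; apply: (SP _ SF).1.1 => //; exact: GF.
have F0 : F !=set0.
  apply: contrapT => /set0P/negP; rewrite negbK => /eqP F0.
  pose G := [set z | exists a, z = (a *: b, a * `|b|)].
  apply: (Fmax G).
    rewrite F0; split=> // /(_ (0, 0)); apply.
    by exists 0; rewrite scale0r mul0r.
  split; last by move=> _; exists 1; rewrite scale1r mul1r.
  split.
    move=> a _ _ _ _ [r [-> ->]] [s [-> ->]]; exists (a * r + s).
    by rewrite scalerDl scalerA mulrDl mulrA.
  by move=> _ _ [a [-> ->]]; rewrite normrZ ler_wpM2r// ler_norm.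
have Ftot v : exists r, F (v, r).
  apply: contrapT => nF.
  have [c Gc] := dominated_graph_extend v (conj Flin Fle) F0.
  apply: (Fmax _ _ (conj Gc _)); last first.
    move=> _; exists b, `|b|, 0; split; first exact: Fb.
    by rewrite scale0r mul0r !addr0.
  have F00 : F (0, 0).
    have := Flin (-1) _ _ _ _ (Fb F0) (Fb F0).
    by rewrite scaleN1r addNr mulN1r addNr.
  split.
    by move=> [u r] Fu; exists u, r, 0; split => //; rewrite scale0r mul0r !addr0.
  move=> GF; apply: nF; exists c; apply: GF.
  by exists 0, 0, 1; rewrite scale1r mul1r !add0r.
have [f fF] := choice Ftot.
have Funiq v r : F (v, r) -> f v = r.
  move=> Fv.
  have := Fle _ _ (Flin (-1) _ _ _ _ Fv (fF v)).
  have := Fle _ _ (Flin (-1) _ _ _ _ (fF v) Fv).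
  by rewrite scaleN1r addNr normr0; lra.
exists f; split.
- by move=> a u v; apply: Funiq; exact: Flin.
- by move=> u; exact: Fle (fF u).
- by apply: Funiq; exact: Fb.
Qed.

End HahnBanach.

(** * Borel sets described by countably many functionals *)

Section BorelCylinders.
Context {R : realType} {B : normedModType R}.

Lemma continuous_borel_measurable (f : B -> R) :
  continuous f -> measurable_fun setT (f : borel B -> R).
Proof.
move=> /continuousP cf.
apply: (measurability _ (RGenOpens.measurableE R)) => _ [_ [a [b ->]] <-].
rewrite setTI; apply: sub_sigma_algebra.
by apply: cf; exact: interval_open.
Qed.

Lemma dual_elt_measurable (x : B -> R) :
  dual_elt x -> measurable_fun setT (x : borel B -> R).
Proof. by case=> _; exact: continuous_borel_measurable. Qed.

Lemma linear_eq0 (f : B -> R) :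
  (forall a u v, f (a *: u + v) = a * f u + f v) -> f 0 = 0.
Proof. by move=> /(_ (-1) 0 0); rewrite scaler0 addr0; lra. Qed.

Lemma linear_funB (f : B -> R) u v :
  (forall a u v, f (a *: u + v) = a * f u + f v) -> f (u - v) = f u - f v.
Proof. by move=> lf; rewrite addrC -scaleN1r lf mulN1r addrC. Qed.

Lemma bounded_dual_elt (f : B -> R) (C : R) :
  (forall a u v, f (a *: u + v) = a * f u + f v) ->
  (forall u, f u <= C * `|u|) -> dual_elt f.
Proof.
move=> lf fC; split => // u.
have fC' w : `|f w| <= C * `|w|.
  rewrite ler_norml fC andbT lerNl -mulN1r.
  have := lf (-1) w 0; rewrite linear_eq0// !addr0 => <-.
  by rewrite scaleN1r (le_trans (fC _))// normrN.
have [C0|C0] := leP C 0.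
  have f0 w : f w = 0.
    apply/eqP; rewrite -normr_le0 (le_trans (fC' _))//.
    by rewrite mulr_le0_ge0.
  by rewrite (_ : f = cst 0); [exact: cvg_cst|exact/funext].
apply/cvgrPdist_lt => e e0; near=> v.
rewrite -linear_funB// (le_lt_trans (fC' _))//.
rewrite mulrC -ltr_pdivlMr//.
by near: v; apply: cvgr_dist_lt => //; rewrite divr_gt0.
Unshelve. all: by end_near. Qed.

Context (D : nat -> B).
Hypothesis denseD : forall b e, 0 < e -> exists n, `|b - D n| < e.

(** Functionals norming the points of a dense sequence suffice: each has norm at most 1, so moving
    [b] to a nearby [D n] costs at most twice the distance. *)
Lemma norming_sequence : exists x : nat -> B -> R,
  (forall n, dual_elt (x n)) /\
  forall b r, `|b| <= r <-> forall n, x n b <= r.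
Proof.
have /choice[x xP] : forall n, exists f : B -> R,
    [/\ forall a u v, f (a *: u + v) = a * f u + f v,
    forall u, f u <= `|u| & f (D n) = `|D n|].
  by move=> n; exact: norming_functional.
exists x; split.
  move=> n; have [xl xb _] := xP n.
  by apply: (@bounded_dual_elt _ 1) => // u; rewrite mul1r.
move=> b r; split.
  by move=> br n; have [_ xb _] := xP n; exact: le_trans br.
move=> xr; apply/ler_addgt0Pl => e e0.
have [n bn] := denseD b (divr_gt0 e0 (ltr0n _ 2)).
have [xl xb xn] := xP n.
have := xb (D n - b); rewrite linear_funB// xn distrC => h.
have := xr n; have := ler_normD (b - D n) (D n); rewrite subrK.
by move: h bn; lra.
Qed.

(** A closed ball is a countable intersection of half-spaces given by the norming sequence, and an
    open set is a countable union of closed balls with centres in [D] and radii [1/(m+1)]. *)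
Lemma measurable_fun_borel_dual d (T : measurableType d) (f : T -> borel B) :
  (forall x : B -> R, dual_elt x -> measurable_fun setT (x \o f)) ->
  measurable_fun setT f.
Proof.
move=> mf; have [x [xd xP]] := norming_sequence.
have mball c r : measurable [set t | `|(f t : B) - c| <= r].
  have -> : [set t | `|(f t : B) - c| <= r] =
      \bigcap_n ((x n \o f) @^-1` `]-oo, r + x n c]).
    apply/seteqP; split => t /=.
      move/xP => h n _ /=; rewrite in_itv/= -lerBlDr.
      by rewrite -linear_funB//; case: (xd n).
    move=> h; apply/xP => n; have := h n I.
    by rewrite /= in_itv/= -lerBlDr -linear_funB//; case: (xd n).
  apply: bigcap_measurable => // n _; rewrite -[X in measurable X]setTI.
  exact: mf.
apply: (@measurability _ _ T (borel B) setT f (@open B) erefl) => // _ [U oU <-];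
  rewrite setTI.
pose K := [set nm : nat * nat | closed_ball (D nm.1) nm.2.+1%:R^-1 `<=` U].
have UE (z : B) : U z <-> exists2 nm, K nm & `|z - D nm.1| <= nm.2.+1%:R^-1.
  split; last first.
    move=> [[n m] /= nmU zn]; apply: nmU.
    by rewrite closed_ballE ?invr_gt0// /closed_ball_ /= distrC.
  move=> Uz; have /nbhs_ballP[e /= e0 eU] : nbhs z U.
    by apply: open_nbhs_nbhs; split.
  have /ltr_add_invr[m] : 0 < e / 2 by rewrite divr_gt0.
  rewrite add0r => me.
  have m0 : 0 < m.+1%:R^-1 :> R by rewrite invr_gt0.
  have [n zn] := denseD z m0.
  exists (n, m) => /=; last exact: ltW.
  rewrite /K/= closed_ballE// => y; rewrite /closed_ball_/= => yn; apply: eU.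
  rewrite -ball_normE/=.
  have := ler_normD (z - D n) (D n - y); rewrite addrA subrK.
  move=> h; rewrite (le_lt_trans h)// (splitr e) ltrD// ?(lt_trans zn)//.
  exact: le_lt_trans me.
have -> : f @^-1` U =
   \bigcup_(nm in K) [set t | `|(f t : B) - D nm.1| <= nm.2.+1%:R^-1].
  by apply/seteqP; split => t /UE.
rewrite bigcup_mkcond; apply: countable_bigcupT_measurable => // -[n m].
by case: ifP => // _; exact: mball.
Qed.

End BorelCylinders.

(** * Gaussian sums *)

Lemma ge0_integral_law d d' (T : measurableType d) (T' : measurableType d')
    (R : realType) (m : {measure set T -> \bar R}) (m' : {measure set T' -> \bar R})
    (f : T' -> T) (g : T -> \bar R) :
  measurable_fun setT f ->
  (forall A, measurable A -> m A = m' (f @^-1` A)) ->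
  measurable_fun setT g -> (forall x, 0 <= g x)%E ->
  (\int[m]_x g x = \int[m']_x g (f x))%E.
Proof.
move=> mf mE mg g0.
rewrite (@eq_measure_integral _ _ _ _
  (measure_function_pushforward__canonical__measure_function_Measure m' mf)).
  by rewrite ge0_integral_pushforward//= preimage_setT.
by move=> A mA _; exact: mE.
Qed.

Section NormalSequence.
Context {R : realType}.
Local Notation leb := (@lebesgue_measure R).
Local Notation P := (@coin_measure R).
Local Notation phi := (@normal_pdf R 0 1).

(** One step of the recursion of [gauss_int]: the even tosses give a normal variable, the odd ones
    an independent copy of the whole sequence. *)
Lemma ge0_integral_coin_split (g : R * coins -> \bar R) :
  measurable_fun setT g -> (forall z, 0 <= g z)%E ->
  (\int[P]_om g (coin_normal (evens om), odds om) =
   \int[leb]_t ((phi t)%:E * \int[P]_om g (t, om)))%E.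
Proof.
move=> mg g0.
have mN := @measurable_coin_normal R.
have mh : measurable_fun setT (fun om : coins => g (coin_normal (evens om), odds om)).
  apply: (measurableT_comp mg); apply: measurable_fun_pair.
    exact: measurableT_comp mN measurable_evens.
  exact: measurable_odds.
have mF : measurable_fun setT (fun t : R => (\int[P]_om g (t, om))%E).
  exact: (@measurable_fun_fubini_tonelli_F _ _ _ _ _ P _ mg g0).
rewrite (@ge0_integral_law _ _ _ _ _ _ (P \x P)%E _ _ measurable_ileave)//; last first.
  by move=> A mA; rewrite -[LHS]coin_measure_ileave.
under eq_integral do rewrite evens_ileave odds_ileave.
rewrite (@fubini_tonelli1 _ _ _ _ _ _ _ (fun z => g (coin_normal z.1, z.2)))//=;
  last first.
  apply: (measurableT_comp mg); apply: measurable_fun_pair => //.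
  exact: (measurableT_comp mN).
rewrite -ge0_integral_std_normal//; last by move=> t; apply: integral_ge0.
rewrite (@ge0_integral_law _ _ (measurableTypeR R) coins R (normal_prob 0 1) P
  coin_normal _ mN)//.
- by move=> A mA; rewrite -[LHS]coin_normal_law.
- by move=> t; apply: integral_ge0.
Qed.

(** Each variable reads its own infinite set of tosses: the even ones, then the even ones among the
    odd ones, and so on. The recursion peels off variables in the order in which [gauss_int]
    integrates them. *)
Fixpoint coin_seq (n : nat) (om : coins) : R :=
  if n is n'.+1 then coin_seq n' (odds om) else coin_normal (evens om).

Definition coin_sum (V : lmodType R) (v : nat -> V) (n : nat) (om : coins) : V :=
  \sum_(i < n) coin_seq i om *: v i.

Lemma coin_sumS (V : lmodType R) (v : nat -> V) n om :
  coin_sum v n.+1 om =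
  coin_normal (evens om) *: v 0%N + coin_sum (v \o succn) n (odds om).
Proof. by rewrite /coin_sum big_ord_recl. Qed.

Lemma coin_sum_linear (V : normedModType R) (W : lmodType R) (x : V -> W) (v : nat ->
  V) n om :
  (forall a u w, x (a *: u + w) = a *: x u + x w) ->
  x (coin_sum v n om) = coin_sum (x \o v) n om.
Proof.
move=> xl; have x0 : x 0 = 0.
  by have := xl (-1) 0 0; rewrite scaler0 addr0 scaleN1r addNr.
elim: n v om => [|n IH] v om; first by rewrite /coin_sum !big_ord0.
by rewrite !coin_sumS xl IH.
Qed.

Lemma measurable_coin_sum (a : nat -> R) n :
  measurable_fun setT (coin_sum (a : nat -> R^o) n).
Proof.
elim: n a => [|n IH] a.
  rewrite (_ : coin_sum _ _ = cst 0)//; apply/funext => om.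
  by rewrite /coin_sum big_ord0.
rewrite (_ : coin_sum _ _ = fun om => coin_normal (evens om) * a 0%N +
    coin_sum (a \o succn : nat -> R^o) n (odds om)); last first.
  by apply/funext => om; rewrite coin_sumS.
apply: measurable_funD.
  apply: measurable_funM => //.
  exact: measurableT_comp (@measurable_coin_normal R) measurable_evens.
exact: measurableT_comp (IH _) measurable_odds.
Qed.

(** Adding 1 makes the integrand nonnegative, as the splitting lemma requires. With the first
    variable equal to [t], the induction hypothesis is applied at the phase [s + t * a 0]; the
    Gaussian characteristic function then integrates over [t]. *)
Lemma ge0_integral_coin_cos (a : nat -> R) n s :
  (\int[P]_om (1 + cos (s + coin_sum (a : nat -> R^o) n om))%:E =
   (1 + expR (- ((\sum_(i < n) a i ^+ 2) / 2)) * cos s)%:E)%E.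
Proof.
have cos1 (y : R) : 0 <= 1 + cos y by have := cos_geN1 y; lra.
elim: n a s => [|n IH] a s.
  under eq_integral do rewrite /coin_sum big_ord0 addr0.
  rewrite integral_cst//= coin_measure_setT mule1 big_ord0 mul0r oppr0 expR0 mul1r//.
pose g (z : R * coins) : \bar R :=
  (1 + cos (s + (z.1 * a 0%N + coin_sum (a \o succn : nat -> R^o) n z.2)))%:E.
under eq_integral do rewrite coin_sumS.
have mg : measurable_fun setT g.
  apply/measurable_EFinP; apply: measurable_funD => //.
  apply: (measurableT_comp (f := @cos R)).
    by apply: continuous_measurable_fun; exact: continuous_cos.
  apply: measurable_funD => //; apply: measurable_funD.
    exact: measurable_funM.
  exact: (measurableT_comp (measurable_coin_sum _ _)).
have g0 z : (0 <= g z)%E by rewrite lee_fin.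
have /= -> := ge0_integral_coin_split mg g0; rewrite /g/=.
under eq_integral => t _.
  under eq_integral do rewrite addrA.
  rewrite IH -EFinM mulrDr mulr1 EFinD mulrCA (mulrC t).
  over.
rewrite integralD//=; last 2 first.
- exact: integrable_normal_pdf.
- by under eq_fun do rewrite EFinM; apply: integrableZl => //;
  exact: integrable_std_normal_cos.
rewrite integral_normal_pdf.
under eq_integral do rewrite EFinM.
rewrite integralZl//; last exact: integrable_std_normal_cos.
rewrite integral_std_normal_cos -EFinM -EFinD; congr (1 + _)%:E.
rewrite mulrA -expRD; congr (expR _ * _).
rewrite big_ord_recl /=; lra.
Qed.

Lemma coin_cos_integrable (a : nat -> R) n s :
  P.-integrable setT (fun om => (cos (s + coin_sum (a : nat -> R^o) n om))%:E).
Proof.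
apply: (@le_integrable _ _ _ _ _ _ _ (cst 1%E)) => //.
- apply/measurable_EFinP; apply: (measurableT_comp (f := @cos R)).
    by apply: continuous_measurable_fun; exact: continuous_cos.
  by apply: measurable_funD => //; exact: measurable_coin_sum.
- by move=> om _; rewrite /= lee_fin normr1 cos_max.
- exact: finite_measure_integrable_cst.
Qed.

Lemma integral_coin_cos (a : nat -> R) n s :
  (\int[P]_om (cos (s + coin_sum (a : nat -> R^o) n om))%:E =
   (expR (- ((\sum_(i < n) a i ^+ 2) / 2)) * cos s)%:E)%E.
Proof.
have := ge0_integral_coin_cos a n s.
under eq_integral do rewrite EFinD.
rewrite integralD//; last 2 first.
- exact: finite_measure_integrable_cst.
- exact: coin_cos_integrable.
rewrite integral_cst//= coin_measure_setT mule1 EFinD.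
by case: (\int[P]_om _)%E => [r| |] //= [/addrI ->].
Qed.

End NormalSequence.

Section GaussIntegral.
Context {R : realType} {H B : normedModType R}.
Local Notation leb := (@lebesgue_measure R).
Local Notation P := (@coin_measure R).

Lemma gauss_int_ge0 (es : seq H) (f : H -> \bar R) :
  (forall v, 0 <= f v)%E -> (0 <= gauss_int es f)%E.
Proof.
elim: es f => [|e es IH] f f0 //=; apply: integral_ge0 => t _.
by rewrite mule_ge0 ?lee_fin ?normal_pdf_ge0//; exact: IH.
Qed.

(** A zero vector leaves the integrand independent of its variable, which integrates to 1. This
    removes the zero vectors that Gram-Schmidt may produce and leaves an orthonormal family. *)
Lemma gauss_int_filter (es : seq H) (f : H -> \bar R) :
  (forall v, 0 <= f v)%E ->
  gauss_int es f = gauss_int [seq e <- es | e != 0] f.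
Proof.
elim: es f => [|e es IH] f f0 //=; have [->|e0] /= := eqVneq e 0; last first.
  by apply: eq_integral => t _; rewrite IH.
under eq_integral => t _.
  rewrite (_ : (fun v => _) = f); last by apply/funext => v; rewrite scaler0 add0r.
  over.
rewrite ge0_integralZr//=; last 3 first.
- by apply/measurable_EFinP; exact: measurable_normal_pdf.
- by move=> t _; rewrite lee_fin normal_pdf_ge0.
- exact: gauss_int_ge0.
by rewrite integral_normal_pdf mul1e; exact: IH.
Qed.

Context (D : nat -> B).
Hypothesis denseD : forall b e, 0 < e -> exists n, `|b - D n| < e.

Lemma measurable_coin_sum_borel (b : nat -> B) n :
  measurable_fun setT (coin_sum b n : coins -> borel B).
Proof.
apply: (measurable_fun_borel_dual denseD) => x [xl xc].
rewrite (_ : x \o _ = coin_sum (x \o b : nat -> R^o) n).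
  exact: measurable_coin_sum.
by apply/funext => om; exact: (@coin_sum_linear R B R^o x).
Qed.

(** The translation [b0] is there for the induction: it collects the terms whose variables have
    already been fixed. *)
Lemma gauss_int_coin_sum (j : H -> B) (F : borel B -> \bar R) (v : nat -> H) n (b0 : B)
  :
  (forall a u w, j (a *: u + w) = a *: j u + j w) ->
  measurable_fun setT F -> (forall b, 0 <= F b)%E ->
  gauss_int (mkseq v n) (fun h => F (b0 + j h)) =
  (\int[P]_om F (b0 + coin_sum (j \o v) n om)%R)%E.
Proof.
move=> jl mF F0; have j0 : j 0 = 0.
  by have := jl (-1) 0 0; rewrite scaler0 addr0 scaleN1r addNr.
elim: n v b0 => [|n IH] v b0.
  under eq_integral do rewrite /coin_sum big_ord0.
  by rewrite /= integral_cst//= coin_measure_setT mule1 j0.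
have -> : mkseq v n.+1 = v 0%N :: mkseq (v \o succn) n.
  by rewrite /mkseq /= -[1%N]addn0 iotaDl -map_comp.
rewrite /=.
under eq_integral => t _.
  under eq_fun do rewrite jl addrA.
  rewrite IH; over.
under [RHS]eq_integral do rewrite coin_sumS addrA.
pose g (z : R * coins) := F (b0 + z.1 *: j (v 0%N) + coin_sum (j \o v \o succn) n z.2).
rewrite -(@ge0_integral_coin_split R g)//; last by move=> z; exact: F0.
apply: (measurableT_comp mF); apply: (measurable_fun_borel_dual denseD) => x [xl xc].
rewrite (_ : x \o _ = fun z => x b0 + z.1 * x (j (v 0%N)) +
    coin_sum (x \o (j \o v \o succn) : nat -> R^o) n z.2).
  apply: measurable_funD.
    apply: measurable_funD => //; exact: measurable_funM.
  exact: (measurableT_comp (measurable_coin_sum _ _)).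
apply/funext => -[t om] /=.
rewrite -(@coin_sum_linear R B R^o x)//.
have xD u w : x (u + w) = x u + x w by have := xl 1 u w; rewrite scale1r mul1r.
rewrite !xD; congr (_ + _ + _).
by have := xl t (j (v 0%N)) 0; rewrite !addr0 (linear_eq0 xl) addr0.
Qed.

End GaussIntegral.

(** * Uniqueness *)

Section Separation.
Context {R : realType}.

Lemma cvg_natM_expRN (c : R) : 0 < c -> n%:R * expR (- (n%:R * c)) @[n --> \oo] --> (0
  : R).
Proof.
(* The bound is [exp(n c / 2) >= n c / 2] squared, inverted and multiplied by [n]. *)
move=> c0; apply: (@squeeze_cvgr _ _ _ _ (cst 0) (fun n => 4 / c ^+ 2 * n%:R^-1)).
- near=> n; rewrite mulr_ge0 ?expR_ge0//=.
  have n0 : 0 < n%:R :> R by rewrite ltr0n; near: n; exact: nbhs_infty_gt.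
  rewrite expRN -[leRHS]mulr1 -ler_pdivrMl; last by rewrite mulr_gt0 ?invr_gt0//
    divr_gt0// exprn_gt0.
  rewrite mulrA ler_pdivrMr ?expR_gt0// mul1r.
  have nc : 0 < n%:R * c / 2 by rewrite divr_gt0// mulr_gt0.
  have h := expR_ge1Dx (n%:R * c / 2).
  have -> : expR (n%:R * c) = expR (n%:R * c / 2) ^+ 2.
    by rewrite expr2 -expRD -splitr.
  have -> : (4 / c ^+ 2 / n%:R)^-1 * n%:R = (n%:R * c / 2) ^+ 2 :> R.
    by field; rewrite ?gt_eqF.
  by rewrite lerXn2r ?nnegrE ?expR_ge0 ?(ltW nc)//; lra.
- exact: cvg_cst.
- rewrite -[X in _ --> X](mulr0 (4 / c ^+ 2)); apply: cvgMr.
  by apply/gtr0_cvgV0; [near=> n; rewrite ltr0n; near: n;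
    exact: nbhs_infty_gt|exact: cvgr_idn].
Unshelve. all: by end_near. Qed.

Lemma bernoulli_le (z : R) m : 0 <= z <= 1 -> 1 - m%:R * z <= (1 - z) ^+ m.
Proof.
move=> /andP[z0 z1]; elim: m => [|m IH]; first by rewrite mul0r subr0 expr0.
rewrite exprS; have m0 : 0 <= m%:R :> R by [].
have : (1 - z) * (1 - m%:R * z) <= (1 - z) * (1 - z) ^+ m by rewrite ler_wpM2l//; lra.
rewrite -natr1; have : 0 <= m%:R * (z * z) by rewrite !mulr_ge0.
lra.
Qed.

(* The factor [n] in the exponent makes the limit vanish at the threshold
   [th = ln 2] too. *)
Lemma cvg_threshold (th : R) : 0 <= th ->
  (1 - expR (- th) ^+ n) ^+ (n * 2 ^ n) @[n --> \oo] --> ((ln 2 < th)%R%:R : R).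
Proof.
move=> th0.
have u0 n : 0 <= expR (- th) ^+ n :> R by rewrite exprn_ge0 ?expR_ge0.
have u1 n : expR (- th) ^+ n <= 1 :> R.
  by rewrite exprn_ile1 ?expR_ge0// -expR0 ler_expR; lra.
have e2 n : (n * 2 ^ n)%:R * expR (- th) ^+ n = n%:R * expR (- (n%:R * (th - ln 2))) :>
  R.
  rewrite natrM natrX -mulrA -exprMn; congr (_ * _).
  rewrite -{1}[2](@lnK R) ?posrE// -expRD -expRM_natl; congr expR; lra.
have [lt|ge] := ltP (ln 2) th => /=.
  apply: (@squeeze_cvgr _ _ _ _ (fun n => 1 - n%:R * expR (- (n%:R * (th - ln 2))))
    (cst 1)).
  - near=> n; rewrite -e2 bernoulli_le ?u0 ?u1//= exprn_ile1//; have := u0 n;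
    have := u1 n; lra.
  - rewrite -[X in _ --> X]subr0; apply: cvgB; first exact: cvg_cst.
    by apply: cvg_natM_expRN; rewrite subr_gt0.
  - exact: cvg_cst.
apply: (@squeeze_cvgr _ _ _ _ (cst 0) (fun n => expR (- 1) ^+ n)).
- near=> n; have := u0 n; have := u1 n => h1 h0.
  rewrite exprn_ge0/=; last by lra.
  apply: (@le_trans _ _ (expR (- (expR (- th) ^+ n)) ^+ (n * 2 ^ n))).
    by rewrite lerXn2r ?nnegrE ?expR_ge0 ?expR_ge1Dx//; lra.
  rewrite -[leLHS]expRM_natl -[leRHS]expRM_natl ler_expR mulrN mulrN1 lerN2 e2
    ler_peMr//.
  rewrite -[leLHS]expR0 ler_expR oppr_ge0 mulr_ge0_le0//; lra.
- exact: cvg_cst.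
- by apply: cvg_expr; rewrite ger0_norm ?expR_ge0// -expR0 ltr_expR; lra.
Unshelve. all: by end_near. Qed.

End Separation.

Section Uniqueness.
Context {R : realType} {B : normedModType R}.
Local Notation P := (@coin_measure R).

Lemma dual_elt0 : dual_elt (fun _ : B => 0 : R).
Proof. by split; [move=> *; rewrite mulr0 addr0|move=> b; exact: cvg_cst]. Qed.

Lemma dual_elt_lin (a : R) (x y : B -> R) : dual_elt x -> dual_elt y ->
  dual_elt (fun b => a * x b + y b).
Proof.
move=> [xl xc] [yl yc]; split.
  by move=> c u v; rewrite xl yl; lra.
by move=> b; apply: cvgD; [apply: cvgM; [exact: cvg_cst|exact: xc]|exact: yc].
Qed.

Lemma dual_elt_sum (a : nat -> R) (x : nat -> B -> R) n :
  (forall k, dual_elt (x k)) -> dual_elt (fun b => \sum_(k < n) a k * x k b).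
Proof.
move=> xd; elim: n => [|n IH].
  by under eq_fun do rewrite big_ord0; exact: dual_elt0.
under eq_fun do rewrite big_ord_recr/= addrC.
exact: dual_elt_lin.
Qed.

(** By the Gaussian characteristic function, this is the expectation of the cosine of
    [\sum_k X_k (x_k b - y_k)] with independent standard normal [X_k]: a mixture of cosines of
    functionals in the dual. *)
Definition gauss_weight (q : seq ((B -> R) * R)) (b : B) : R :=
  expR (- ((\sum_(z <- q) (z.1 b - z.2) ^+ 2) / 2)).

Definition dual_seq (q : seq ((B -> R) * R)) := forall z, z \in q -> dual_elt z.1.

Lemma gauss_weight_cat q r b :
  gauss_weight (q ++ r) b = gauss_weight q b * gauss_weight r b.
Proof. by rewrite /gauss_weight big_cat/= -expRD; congr expR; lra. Qed.

Lemma gauss_weight01 q b : 0 <= gauss_weight q b <= 1.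
Proof.
rewrite expR_ge0 -expR0 ler_expR oppr_le0 divr_ge0// sumr_ge0// => z _.
exact: sqr_ge0.
Qed.

Lemma measurable_gauss_weight q : dual_seq q ->
  measurable_fun setT (gauss_weight q : borel B -> R).
Proof.
move=> qd; apply: measurableT_comp => //; apply: measurableT_comp => //.
apply: measurable_funM => //.
elim: q qd => [|z q IH] qd; first by under eq_fun do rewrite big_nil;
  exact: measurable_cst.
under eq_fun do rewrite big_cons.
apply: measurable_funD.
  apply: measurable_funX; apply: measurable_funB => //.
  by apply: dual_elt_measurable; apply: qd; rewrite inE eqxx.
by apply: IH => y yq; apply: qd; rewrite inE yq orbT.
Qed.

(** Tonelli exchanges the two integrals. For fixed [om] the inner integrand is a phase-shifted
    cosine of a single element of the dual, so it is governed by the characteristic functional. *)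
Lemma integral_gauss_weight (mu : probability (borel B) R) (q : seq ((B -> R) * R)) :
  dual_seq q ->
  (\int[mu]_b (1 + gauss_weight q b)%:E =
   \int[P]_om \int[mu]_b
     (1 + cos ((\sum_(k < size q) coin_seq k om * (nth (fun=> 0, 0) q k).1 b) +
               - \sum_(k < size q) coin_seq k om * (nth (fun=> 0, 0) q k).2))%:E)%E.
Proof.
move=> qd; pose x k := (nth (fun=> 0 : R, 0 : R) q k).1 : B -> R.
pose y k := (nth (fun=> 0 : R, 0 : R) q k).2.
have xd k : dual_elt (x k).
  rewrite /x; have [kq|kq] := ltnP k (size q); last by rewrite nth_default//;
    exact: dual_elt0.
  by apply: qd; exact: mem_nth.
pose f (z : borel B * coins) : \bar R :=
  (1 + cos ((\sum_(k < size q) coin_seq k z.2 * x k z.1) +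
               - \sum_(k < size q) coin_seq k z.2 * y k))%:E.
have mseq k : measurable_fun setT (@coin_seq R k).
  elim: k => [|k IH] /=; first exact: measurableT_comp (@measurable_coin_normal R)
    measurable_evens.
  exact: measurableT_comp IH measurable_odds.
have mf : measurable_fun setT f.
  apply/measurable_EFinP; apply: measurable_funD => //.
  apply: (measurableT_comp (f := @cos R)).
    by apply: continuous_measurable_fun; exact: continuous_cos.
  apply: measurable_funD.
    apply: measurable_sum => k; apply: measurable_funM;
      first exact: (measurableT_comp (mseq _)).
    exact: (measurableT_comp (dual_elt_measurable (xd k))).
  apply: measurableT_comp => //.
  apply: measurable_sum => k; apply: measurable_funM => //.
  exact: (measurableT_comp (mseq _)).
have f0 z : (0 <= f z)%E by rewrite lee_fin; have := cos_geN1 (\sum_(k < size q)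
  coin_seq k z.2 * x k z.1 - \sum_(k < size q) coin_seq k z.2 * y k); lra.
have /= <- := @fubini_tonelli _ _ _ _ _ mu P f mf f0.
apply: eq_integral => b _; rewrite /f/=.
have := ge0_integral_coin_cos (fun k => x k b - y k) (size q) 0.
rewrite cos0 mulr1 /gauss_weight (big_nth (fun=> 0, 0)) big_mkord => <-.
apply: eq_integral => om _; rewrite add0r -sumrB /coin_sum.
by congr (1 + cos _)%:E; apply: eq_bigr => k _; rewrite -mulrBr.
Qed.

End Uniqueness.

Lemma probability_integrable_le1 d (T : measurableType d) (R : realType)
    (m : probability T R) (f : T -> R) :
  measurable_fun setT f -> (forall t, `|f t| <= 1) ->
  m.-integrable setT (fun t => (f t)%:E).
Proof.
move=> mf f1; apply: (@le_integrable _ _ _ _ _ _ _ (EFin \o cst 1)) => //.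
- exact/measurable_EFinP.
- by move=> t _; rewrite /= lee_fin normr1.
- exact: finite_measure_integrable_cst.
Qed.

Section CharacteristicFunctionalUniqueness.
Context {R : realType} {B : normedModType R}.
Variables mu nu : probability (borel B) R.
Hypothesis cosE : forall x : B -> R, dual_elt x ->
  (\int[mu]_b (cos (x b))%:E = \int[nu]_b (cos (x b))%:E)%E.
Hypothesis sinE : forall x : B -> R, dual_elt x ->
  (\int[mu]_b (sin (x b))%:E = \int[nu]_b (sin (x b))%:E)%E.

Let mcos (x : B -> R) : dual_elt x -> measurable_fun setT (fun b : borel B => cos (x
  b)).
Proof.
move=> xd; apply: (measurableT_comp (f := @cos R)); last exact: dual_elt_measurable.
by apply: continuous_measurable_fun; exact: continuous_cos.
Qed.

Let msin (x : B -> R) : dual_elt x -> measurable_fun setT (fun b : borel B => sin (x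
  b)).
Proof.
move=> xd; apply: (measurableT_comp (f := @sin R)); last exact: dual_elt_measurable.
by apply: continuous_measurable_fun; exact: continuous_sin.
Qed.

Let shiftE (m : probability (borel B) R) (x : B -> R) s : dual_elt x ->
  (\int[m]_b (1 + cos (x b + s))%:E =
   1 + (cos s)%:E * \int[m]_b (cos (x b))%:E -
   (sin s)%:E * \int[m]_b (sin (x b))%:E)%E.
Proof.
move=> xd.
have ic : m.-integrable setT (fun b : borel B => (cos (x b))%:E).
  by apply: probability_integrable_le1; [exact: mcos|move=> b; exact: cos_max].
have isn : m.-integrable setT (fun b : borel B => (sin (x b))%:E).
  by apply: probability_integrable_le1; [exact: msin|move=> b; exact: sin_max].
have i1 : m.-integrable setT (fun b : borel B => 1%:E).
  exact: finite_measure_integrable_cst.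
under eq_integral => b _.
  rewrite cosD mulrC [sin _ * _]mulrC EFinD EFinB !EFinM addeA.
  over.
rewrite integralB//=; last 2 first.
- by apply: integrableD => //; apply: integrableZl.
- exact: integrableZl.
rewrite integralD//=; last exact: integrableZl.
by rewrite !integralZl// integral_cst//= probability_setT mule1.
Qed.

Let weightE q : dual_seq q ->
  (\int[mu]_b (gauss_weight q b)%:E = \int[nu]_b (gauss_weight q b)%:E)%E.
Proof.
move=> qd.
have : (\int[mu]_b (1 + gauss_weight q b)%:E = \int[nu]_b (1 + gauss_weight q b)%:E)%E.
  rewrite !integral_gauss_weight//; apply: eq_integral => om _.
  have xd : dual_elt (fun b => \sum_(k < size q) coin_seq k om * (nth (fun=> 0 : R, 0 :
    R) q k).1 b).
    apply: (@dual_elt_sum R B (fun k => coin_seq k om) (fun k => (nth (fun=> 0, 0) q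
      k).1)) => k.
    have [kq|kq] := ltnP k (size q); last by rewrite nth_default//; exact: dual_elt0.
    by apply: qd; exact: mem_nth.
  by rewrite !(shiftE _ _ xd) cosE// sinE.
have iw (m : probability (borel B) R) : m.-integrable setT (fun b : borel B =>
  (gauss_weight q b)%:E).
  apply: probability_integrable_le1; first exact: measurable_gauss_weight.
  by move=> b; have /andP[w0 w1] := gauss_weight01 q b; rewrite ger0_norm.
have E (m : probability (borel B) R) : (\int[m]_b (1 + gauss_weight q b)%:E =
    1 + \int[m]_b (gauss_weight q b)%:E)%E.
  under eq_integral do rewrite EFinD.
  rewrite integralD//; [|exact: finite_measure_integrable_cst|exact: iw].
  by rewrite integral_cst//= probability_setT mule1.
rewrite !E; have := integrable_fin_num measurableT (iw mu).
have := integrable_fin_num measurableT (iw nu).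
case: (\int[mu]_b _)%E => // r _; case: (\int[nu]_b _)%E => // r' _.
by rewrite /= => -[/addrI ->].
Qed.

(** Testing [v] against every weight makes the property pass to [v (1 - w_r)], because
    [v (1 - w_r) w_q = v w_q - v w_(r ++ q)]. The bounds 0 and 1 serve dominated convergence. *)
Let agree (v : B -> R) := [/\ measurable_fun setT (v : borel B -> R),
  forall b, 0 <= v b <= 1 &
  forall q, dual_seq q -> (\int[mu]_b (v b * gauss_weight q b)%:E =
                        \int[nu]_b (v b * gauss_weight q b)%:E)%E].

Let agree1 : agree (cst 1).
Proof.
split => // [b|q qd]; first by rewrite ler01 lexx.
by under eq_integral do rewrite mul1r; rewrite weightE//; apply: eq_integral => b _;
  rewrite mul1r.
Qed.

Let agreeM v r : dual_seq r -> agree v -> agree (fun b => v b * (1 - gauss_weight r b)).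
Proof.
move=> rd [mv v01 vE]; split.
- apply: measurable_funM => //; apply: measurable_funB => //.
  exact: measurable_gauss_weight.
- move=> b; have /andP[w0 w1] := gauss_weight01 r b; have /andP[v0 v1] := v01 b.
  by apply/andP; split; nra.
move=> q qd.
have rqd : dual_seq (r ++ q) by move=> z; rewrite mem_cat => /orP[/rd|/qd].
have i q' (m : probability (borel B) R) : dual_seq q' ->
    m.-integrable setT (fun b : borel B => (v b * gauss_weight q' b)%:E).
  move=> qd'; apply: probability_integrable_le1.
    by apply: measurable_funM => //; exact: measurable_gauss_weight.
  move=> b; have /andP[w0 w1] := gauss_weight01 q' b; have /andP[v0 v1] := v01 b.
  by rewrite ger0_norm; nra.
have E (m : probability (borel B) R) :
  (\int[m]_b (v b * (1 - gauss_weight r b) * gauss_weight q b)%:E =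
   \int[m]_b (v b * gauss_weight q b)%:E - \int[m]_b (v b * gauss_weight (r ++ q)
     b)%:E)%E.
  rewrite -integralB//; [|exact: i|exact: i].
  by apply: eq_integral => b _; rewrite -EFinB gauss_weight_cat; congr _%:E; lra.
by rewrite !E !vE.
Qed.

Let agreeX v r n : dual_seq r -> agree v ->
  agree (fun b => v b * (1 - gauss_weight r b) ^+ n).
Proof.
move=> rd va; elim: n => [|n IH].
  by under eq_fun do rewrite expr0 mulr1.
by under eq_fun do rewrite exprSr mulrA; exact: agreeM.
Qed.

Let agree_cvg (v : nat -> B -> R) w : (forall n, agree (v n)) ->
  (forall b, v ^~ b @ \oo --> w b) -> agree w.
Proof.
move=> va vw.
have w01 b : 0 <= w b <= 1.
  apply/andP; split.
    rewrite -(cvg_lim (@Rhausdorff R) (vw b)); apply: limr_ge; first by apply/cvg_ex;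
      exists (w b); exact: vw.
    by apply: nearW => n; have [_ /(_ b)/andP[]] := va n.
  rewrite -(cvg_lim (@Rhausdorff R) (vw b)); apply: limr_le; first by apply/cvg_ex;
    exists (w b); exact: vw.
  by apply: nearW => n; have [_ /(_ b)/andP[]] := va n.
have mw : measurable_fun setT (w : borel B -> R).
  apply: (@measurable_fun_cvg _ (borel B) R setT v w).
    by move=> n; have [] := va n.
  by move=> b _; exact: vw.
split => // q qd.
have cv (m : probability (borel B) R) :
    (\int[m]_b (v n b * gauss_weight q b)%:E)%E @[n --> \oo] -->
    (\int[m]_b (w b * gauss_weight q b)%:E)%E.
  apply: (@dominated_cvg _ _ _ _ _ _ _ _ (EFin \o cst 1)) => //.
  - move=> n; apply/measurable_EFinP/measurable_funM; first by have [] := va n.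
    exact: measurable_gauss_weight.
  - move=> b _; apply: cvg_EFin; first exact: nearW.
    by apply: cvgM; [exact: vw|exact: cvg_cst].
  - exact: finite_measure_integrable_cst.
  - move=> n b _; rewrite /= lee_fin; have [_ /(_ b)/andP[v0 v1] _] := va n.
    have /andP[w0 w1] := gauss_weight01 q b.
    by rewrite ger0_norm; nra.
have cm := cv mu; have cn := cv nu.
have vE : (fun n => \int[mu]_b (v n b * gauss_weight q b)%:E)%E =
   (fun n => \int[nu]_b (v n b * gauss_weight q b)%:E)%E.
  by apply/funext => n; have [_ _ ->] := va n.
by move: cm; rewrite vE => cm; exact: cvg_unique cm cn.
Qed.

Let slab (x : B -> R) (y r : R) : set B := [set b | r < `|x b - y|].

(** With one weight [w], the polynomials [(1 - w^n)^(n 2^n)] tend to 1 where [w < 1/2] and to 0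
    elsewhere; rescaling [x] makes [w < 1/2] the condition [r < |x b - y|]. *)
Let agree_slab v x y r : dual_elt x -> 0 < r -> agree v ->
  agree (fun b => v b * \1_(slab x y r) b).
Proof.
move=> xd r0 va.
have l2 : 0 < ln 2 :> R by rewrite ln_gt0// ltr1n.
(* Chosen so that [(c r)^2 / 2 = ln 2]: the weight equals [1/2] exactly when [|x b - y| = r]. *)
pose c := Num.sqrt (2 * ln 2) / r.
have c0 : 0 < c by rewrite divr_gt0// sqrtr_gt0 mulr_gt0.
pose z : (B -> R) * R := (fun b => c * x b, c * y).
have zd : dual_elt z.1.
  have := dual_elt_lin c xd (@dual_elt0 R B).
  by under eq_fun do rewrite addr0.
pose th b := (c * x b - c * y) ^+ 2 / 2.
have zE n b : gauss_weight (nseq n z) b = expR (- th b) ^+ n.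
  elim: n => [|n IH]; first by rewrite /gauss_weight big_nil mul0r oppr0 expR0 expr0.
  rewrite exprS -IH -[nseq n.+1 z]/([:: z] ++ nseq n z) gauss_weight_cat; congr (_ * _).
  by rewrite /gauss_weight big_seq1.
have thE b : (ln 2 < th b) = (r < `|x b - y|).
  rewrite /th -mulrBr exprMn expr_div_n sqr_sqrtr ?mulr_ge0 ?(ltW l2)//.
  rewrite (_ : 2 * ln 2 / r ^+ 2 * _ / 2 = ln 2 * ((x b - y) ^+ 2 / r ^+ 2));
    last first.
    by field; rewrite gt_eqF.
  rewrite ltr_pMr// ltr_pdivlMr ?exprn_gt0// mul1r -(real_normK (num_real (x b - y))).
  by rewrite ltr_pXn2r// nnegrE ltW.
apply: (agree_cvg (v := fun n b => v b * (1 - gauss_weight (nseq n z) b) ^+ (n * 2 ^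
  n))).
  move=> n; apply: agreeX => // y'; rewrite mem_nseq => /andP[_ /eqP ->] //.
move=> b; apply: cvgM; first exact: cvg_cst.
have -> : \1_(slab x y r) b = (ln 2 < th b)%R%:R :> R.
  by rewrite thE indicE; congr (nat_of_bool _)%:R; apply/idP/idP; rewrite inE.
under eq_fun do rewrite zE.
by apply: cvg_threshold; rewrite divr_ge0// sqr_ge0.
Qed.

(** Finite intersections, indexed by lists, form a class stable under intersection; the empty list
    gives the whole space. *)
Let slabs : set (set B) := [set A | exists s : seq ((B -> R) * R * R),
  (forall z, z \in s -> dual_elt z.1.1 /\ 0 < z.2) /\
  A = [set b | forall z, z \in s -> slab z.1.1 z.1.2 z.2 b]].

Let slabs_setI : setI_closed slabs.
Proof.
move=> _ _ [s [sd ->]] [t [td ->]]; exists (s ++ t); split.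
  by move=> z; rewrite mem_cat => /orP[/sd|/td].
apply/seteqP; split => b.
  by move=> [bs bt] z; rewrite mem_cat => /orP[/bs|/bt].
by move=> h; split => z zs; apply: h; rewrite mem_cat zs ?orbT.
Qed.

Let measurable_slab x y r : dual_elt x -> measurable (slab x y r : set (borel B)).
Proof.
move=> xd; have -> : slab x y r = (fun b : borel B => `|x b - y|) @^-1` `]r, +oo[.
  by apply/seteqP; split => b; rewrite /slab/= in_itv/= andbT.
rewrite -[X in measurable X]setTI.
have m : measurable_fun setT (fun b : borel B => `|x b - y|).
  by apply: measurableT_comp => //; apply: measurable_funB => //;
    exact: dual_elt_measurable.
exact: m.
Qed.

Let slabsE A : slabs A -> mu A = nu A.
Proof.
move=> [s [sd ->]].
have : agree \1_[set b | forall z, z \in s -> slab z.1.1 z.1.2 z.2 b].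
  elim: s sd => [|z s IH] sd.
    rewrite (_ : \1_ _ = cst 1)//; apply/funext => b.
    by rewrite indicE mem_set.
  have [z1 z2] : dual_elt z.1.1 /\ 0 < z.2 by apply: sd; rewrite inE eqxx.
  have := @agree_slab _ _ z.1.2 _ z1 z2 (IH (fun y ys => sd y (mem_behead (s := z :: s)
    ys))).
  congr (agree _); apply/funext => b.
  rewrite !indicE -natrM mulnb; congr (nat_of_bool _)%:R.
  apply/idP/idP.
    move=> /andP[]; rewrite !inE => h1 h2 y; rewrite inE => /predU1P[->//|]; exact: h1.
  rewrite !inE => h; apply/andP; split; last by rewrite inE; apply: h; rewrite inE eqxx.
  by rewrite inE => y ys; apply: h; rewrite inE ys orbT.
set S := [set b | _]; move=> [mS _ h].
have w1 b : gauss_weight [::] b = 1 :> R.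
  by rewrite /gauss_weight big_nil mul0r oppr0 expR0.
have {}mS := (measurable_indicP _ _).2 mS.
have E (m : probability (borel B) R) :
    (\int[m]_b (\1_S b * gauss_weight [::] b)%:E = m S)%E.
  by under eq_integral do rewrite w1 mulr1; rewrite integral_indic// setIT.
by rewrite -!E; apply: h => z; rewrite in_nil.
Qed.

Context (D : nat -> B).
Hypothesis denseD : forall b e, 0 < e -> exists n, `|b - D n| < e.

Lemma char_functional_unique A : measurable A -> mu A = nu A.
Proof.
have gen : @measurable _ (borel B) = <<s slabs >>.
  apply/seteqP; split; last first.
    apply: smallest_sub; first exact: sigma_algebra_measurable.
    move=> _ [s [sd ->]].
    elim: s sd => [|z s IH] sd.
      by rewrite (_ : [set _ | _] = setT)//; apply/seteqP; split.
    rewrite (_ : [set _ | _] = slab z.1.1 z.1.2 z.2 `&`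
      [set b | forall z, z \in s -> slab z.1.1 z.1.2 z.2 b]).
      apply: measurableI.
        by apply: measurable_slab; apply: (sd _ _).1; rewrite inE eqxx.
      by apply: IH => y ys; apply: sd; rewrite inE ys orbT.
    apply/seteqP; split => b.
      move=> h; split; first by apply: h; rewrite inE eqxx.
      by move=> y ys; apply: h; rewrite inE ys orbT.
    by move=> [h1 h2] y; rewrite inE => /predU1P[->|/h2].
  pose id' : g_sigma_algebraType slabs -> borel B := id.
  have : measurable_fun setT id'.
    apply: (measurable_fun_borel_dual denseD) => x xd.
    apply: (measurability _ (RGenOInfty.measurableE R)) => _ [_ [c ->] <-].
    rewrite setTI.
    (* Intervals [[c - 2(n+1), c]] are removed. A point with [x b <= c] lies in one of them, namely
       the one whose half-length is an integer exceeding [c - x b]. *)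
    have -> : (x \o id') @^-1` `]c, +oo[ = \bigcap_n slab x (c - n.+1%:R) n.+1%:R.
      apply/seteqP; split => b /=; rewrite in_itv/= andbT /id'.
        move=> cb n _; rewrite /slab/= (lt_le_trans _ (ler_norm _))//.
        by rewrite opprB addrA addrAC ltrDr subr_gt0.
      move=> h; rewrite ltNge; apply/negP => bc.
      have := h (Num.truncn (c - x b)) I; rewrite /slab/=.
      have := truncnS_gt (c - x b); set N := _.+1%:R => hN.
      rewrite ltNge => /negP; apply; rewrite ler_norml; apply/andP; split; lra.
    apply: bigcapT_measurable => n; apply: sub_sigma_algebra.
    exists [:: (x, c - n.+1%:R, n.+1%:R)]; split.
      by move=> z; rewrite inE => /eqP ->.
    apply/seteqP; split => b.
      by move=> h z; rewrite inE => /eqP ->.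
    by move=> /(_ (x, c - n.+1%:R, n.+1%:R)); apply; rewrite inE.
  by move=> mid C mC; have := mid measurableT C mC; rewrite setTI.
apply: (@measure_unique _ R (borel B) slabs (fun=> setT) gen slabs_setI).
- by move=> _; exists [::]; split => //; apply/seteqP; split.
- by apply/seteqP; split => // b _; exists 0%N.
- exact: slabsE.
- by move=> _; rewrite /= probability_setT ltry.
Qed.

End CharacteristicFunctionalUniqueness.

(** * Hilbert space geometry *)

Lemma cauchy_seq_cvg (R : realType) (V : completeNormedModType R) (u : nat -> V) :
  (forall e, 0 < e -> exists N, forall n, (N <= n)%N -> `|u N - u n| < e) ->
  cvgn u.
Proof.
move=> h; apply: cauchy_cvg; apply: cauchy_exP => e e0.
have [N hN] := h _ e0; exists (u N).
by exists N => // n /= /hN; rewrite -ball_normE.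
Qed.

Section InnerProduct.
Context {R : realType} {H : normedModType R} {inner : H -> H -> R}.
Hypothesis ip : is_inner_product inner.

Lemma innerC u v : inner u v = inner v u. Proof. by case: ip. Qed.

Lemma innerP a u v w : inner (a *: u + v) w = a * inner u w + inner v w.
Proof. by case: ip. Qed.

Lemma inner0 w : inner 0 w = 0.
Proof. exact: (@linear_eq0 R H (inner^~ w) (fun a u v => innerP a u v w)). Qed.

Lemma innerD u v w : inner (u + v) w = inner u w + inner v w.
Proof. by have := innerP 1 u v w; rewrite scale1r mul1r. Qed.

Lemma innerZ a u w : inner (a *: u) w = a * inner u w.
Proof. by have := innerP a u 0 w; rewrite inner0 !addr0. Qed.

Lemma innerN u w : inner (- u) w = - inner u w.
Proof. by rewrite -scaleN1r innerZ mulN1r. Qed.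

Lemma innerDr u v w : inner w (u + v) = inner w u + inner w v.
Proof. by rewrite innerC innerD !(innerC _ w). Qed.

Lemma innerZr a u w : inner w (a *: u) = a * inner w u.
Proof. by rewrite innerC innerZ (innerC _ w). Qed.

Lemma innerNr u w : inner w (- u) = - inner w u.
Proof. by rewrite innerC innerN (innerC _ w). Qed.

Lemma inner0r w : inner w 0 = 0. Proof. by rewrite innerC inner0. Qed.

Lemma inner_suml (I : Type) (r : seq I) (P : pred I) (F : I -> H) w :
  inner (\sum_(i <- r | P i) F i) w = \sum_(i <- r | P i) inner (F i) w.
Proof. exact: (big_morph (inner^~ w) (fun u v => innerD u v w) (inner0 w)). Qed.

(** Positivity of [inner] is recovered from the norm: a negative [inner u u] has square root [0],
    which forces [u = 0]. *)
Lemma sqr_normE u : `|u| ^+ 2 = inner u u.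
Proof.
have nE : `|u| = Num.sqrt (inner u u) by case: ip.
have [u0|u0] := leP 0 (inner u u); first by rewrite nE sqr_sqrtr.
have : `|u| = 0 by rewrite nE ler0_sqrtr// ltW.
by move=> /normr0_eq0 ->; rewrite inner0 normr0 expr0n.
Qed.

Lemma norm_pythagoras u v : inner u v = 0 ->
  `|u + v| ^+ 2 = `|u| ^+ 2 + `|v| ^+ 2.
Proof.
by move=> uv; rewrite !sqr_normE innerD !innerDr (innerC v u) uv addr0 add0r.
Qed.

Lemma cauchy_schwarz u v : `|inner u v| <= `|u| * `|v|.
Proof.
have [->|v0] := eqVneq v 0; first by rewrite inner0r !normr0 mulr0.
have v2 : 0 < `|v| ^+ 2 by rewrite exprn_gt0// normr_gt0.
set c := inner u v / `|v| ^+ 2.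
have : `|(u - c *: v) + c *: v| ^+ 2 = `|u - c *: v| ^+ 2 + `|c *: v| ^+ 2.
  apply: norm_pythagoras.
  rewrite innerZr innerD innerN innerZ -sqr_normE /c divfK ?gt_eqF//.
  by rewrite subrr mulr0.
rewrite subrK normrZ exprMn => h.
have : `|c| ^+ 2 * `|v| ^+ 2 <= `|u| ^+ 2 by rewrite h lerDr sqr_ge0.
rewrite /c normrM normfV (ger0_norm (ltW v2)) expr_div_n => h2.
rewrite -(@ler_pXn2r _ 2) ?nnegrE ?mulr_ge0// exprMn.
have : `|inner u v| ^+ 2 / `|v| ^+ 2 ^+ 2 * `|v| ^+ 2 * `|v| ^+ 2 <= `|u| ^+ 2 * `|v|
  ^+ 2.
  by rewrite ler_pM2r.
by rewrite -mulrA -expr2 divfK// gt_eqF// exprn_gt0.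
Qed.

Lemma inner_dual v : dual_elt (inner^~ v).
Proof.
apply: (@bounded_dual_elt R H _ `|v|) => [a u w|u]; first exact: innerP.
by rewrite (le_trans (ler_norm _))// mulrC cauchy_schwarz.
Qed.

Lemma orth_closed_subspace (fs : seq H) :
  closed_subspace [set h | forall f, f \in fs -> inner h f = 0].
Proof.
split.
- by move=> f _; rewrite inner0.
- by move=> a u v hu hv f ff; rewrite innerP hu// hv// mulr0 addr0.
- rewrite (_ : [set h | _] = \bigcap_(f in [set` fs]) ((inner^~ f) @^-1` [set 0])).
    apply: closed_bigI => f _; apply: closed_comp; last exact: closed_eq.
    by move=> u _; have [_] := inner_dual f; exact.
  by apply/seteqP; split => h hh f /hh.
Qed.

End InnerProduct.

(** * Orthogonal projection on a closed subspace *)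

Section Projection.
Context {R : realType} {H : completeNormedModType R} {inner : H -> H -> R}.
Hypothesis ip : is_inner_product inner.
Variable M : set H.
Hypothesis cM : closed_subspace M.

Let M0 : M 0. Proof. by case: cM. Qed.
Let ML a u v : M u -> M v -> M (a *: u + v). Proof. by case: cM => _ h _; exact: h. Qed.

Lemma subspaceD u v : M u -> M v -> M (u + v).
Proof. by move=> Mu Mv; have := ML 1 Mu Mv; rewrite scale1r. Qed.

Lemma subspaceZ a u : M u -> M (a *: u).
Proof. by move=> Mu; have := ML a Mu M0; rewrite addr0. Qed.

Lemma subspaceB u v : M u -> M v -> M (u - v).
Proof. by move=> Mu Mv; rewrite addrC -scaleN1r; exact: ML. Qed.

Lemma subspace_sum n (F : 'I_n -> H) : (forall i, M (F i)) -> M (\sum_(i < n) F i).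
Proof. by move=> MF; elim/big_ind: _ => // u v; exact: subspaceD. Qed.

(** A minimising sequence for the distance to [M] is Cauchy by the parallelogram identity, applied
    through midpoints. Its limit attains the distance, so no move inside [M] can improve on it. *)
Lemma projection_exists h : exists m, M m /\ forall n, M n -> inner (h - m) n = 0.
Proof.
pose S := [set `|h - m| ^+ 2 | m in M].
have S0 : S !=set0 by exists (`|h - 0| ^+ 2), 0.
have Slb : has_lbound S by exists 0 => _ [m _ <-]; exact: sqr_ge0.
pose d := inf S.
have dS m : M m -> d <= `|h - m| ^+ 2 by move=> Mm; apply: ge_inf => //; exists m.
have /choice[u uP] : forall n : nat, exists m, M m /\ `|h - m| ^+ 2 < d + n.+1%:R^-1.
  move=> n; have : d < d + n.+1%:R^-1 by rewrite ltrDl invr_gt0.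
  by move=> /(inf_lt S0)[_ [m Mm <-] lt]; exists m.
have par p q : `|u p - u q| ^+ 2 <= 2 * p.+1%:R^-1 + 2 * q.+1%:R^-1.
  have [Mp hp] := uP p; have [Mq hq] := uP q.
  have Mpq : M (2^-1 *: (u p + u q)) by apply: subspaceZ; exact: subspaceD.
  have := dS _ Mpq; move: hp hq; rewrite !(sqr_normE ip).
  rewrite !(innerD ip, innerN ip, innerDr ip, innerNr ip, innerZ ip, innerZr ip).
  rewrite !(innerC ip _ h) (innerC ip (u q) (u p)).
  set a := inner _ _; move: (p.+1%:R^-1) (q.+1%:R^-1) => x y; lra.
have : cvgn u.
  apply: cauchy_seq_cvg => e e0.
  have /ltr_add_invr[N] : 0 < e ^+ 2 / 4 by rewrite divr_gt0// exprn_gt0.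
  rewrite add0r => hN; exists N => n Nn.
  rewrite -(@ltr_pXn2r _ 2) ?nnegrE// ?(ltW e0)//.
  rewrite (le_lt_trans (par _ _))//.
  have : n.+1%:R^-1 <= N.+1%:R^-1 :> R by rewrite lef_pV2 ?posrE// ler_nat.
  by move: hN; move: (N.+1%:R^-1) (n.+1%:R^-1) => x y; lra.
move=> /cvg_ex[m um].
have Mm : M m.
  have [_ _ clM] := cM; apply: closed_cvg um => //.
  by apply: nearW => n; have [] := uP n.
have hm : `|h - m| ^+ 2 <= d.
  have c1 : `|h - u n| ^+ 2 @[n --> \oo] --> `|h - m| ^+ 2.
    apply: cvgM; apply: cvg_norm; apply: cvgB => //; exact: cvg_cst.
  have c2 : d + n.+1%:R^-1 @[n --> \oo] --> d + 0.
    by apply: cvgD; [exact: cvg_cst|exact: cvg_harmonic].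
  rewrite -[leRHS]addr0; apply: (ler_cvg_to c1 c2).
  by apply: nearW => n; apply: ltW; have [] := uP n.
exists m; split => // n Mn; apply/eqP; apply/negPn/negP => nz.
have [n0|n0] := eqVneq n 0; first by rewrite n0 (inner0r ip) eqxx in nz.
(* Moving [m] by [c *: n] removes the component of [h - m] along [n] and would lower the distance
   strictly. *)
pose c := inner (h - m) n / `|n| ^+ 2.
have n2 : 0 < `|n| ^+ 2 by rewrite exprn_gt0// normr_gt0.
have := dS _ (subspaceD Mm (subspaceZ c Mn)).
have : `|(h - (m + c *: n)) + c *: n| ^+ 2 = `|h - (m + c *: n)| ^+ 2 + `|c *: n| ^+ 2.
  apply: (norm_pythagoras ip).
  rewrite opprD addrA (innerZr ip) (innerD ip) (innerN ip) (innerZ ip) -(sqr_normE ip)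
    /c divfK ?gt_eqF//.
  by rewrite subrr mulr0.
rewrite opprD addrA subrK => e1 h1.
have : 0 < `|c *: n| ^+ 2.
  rewrite exprn_gt0// normr_gt0 scaler_eq0 negb_or n0 andbT /c mulf_neq0//.
  by rewrite invr_eq0 gt_eqF.
by move: hm h1; rewrite e1; lra.
Qed.

Local Notation Pr := (orth_proj inner M).

Lemma orth_projP h : M (Pr h) /\ forall n, M n -> inner (h - Pr h) n = 0.
Proof. by apply: (@xgetPex _ 0 [set m | M m /\ forall n, M n -> inner (h - m) n = 0]);
  exact: projection_exists. Qed.

Lemma orth_proj_in h : M (Pr h). Proof. by case: (orth_projP h). Qed.

Lemma inner_orth_proj h n : M n -> inner h n = inner (Pr h) n.
Proof.
move=> Mn; have [_ /(_ _ Mn)] := orth_projP h.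
by rewrite (innerD ip) (innerN ip) => /subr0_eq.
Qed.

Lemma orth_proj_dist h m : M m -> `|m - Pr h| <= `|m - h|.
Proof.
move=> Mm; have [MP hP] := orth_projP h.
have : `|(m - Pr h) + (Pr h - h)| ^+ 2 = `|m - Pr h| ^+ 2 + `|Pr h - h| ^+ 2.
  apply: (norm_pythagoras ip); rewrite (innerC ip) -opprB (innerN ip) hP ?oppr0//.
  exact: subspaceB.
rewrite addrA subrK => e.
by rewrite -(@ler_pXn2r _ 2) ?nnegrE// e lerDl sqr_ge0.
Qed.

Lemma orth_proj_id m : M m -> Pr m = m.
Proof.
move=> Mm; apply/eqP; rewrite eq_sym -subr_eq0 -normr_le0.
by rewrite (le_trans (orth_proj_dist m Mm))// subrr normr0.
Qed.

Lemma orth_proj_norm h : `|Pr h| <= `|h|.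
Proof. by have := orth_proj_dist h M0; rewrite !sub0r !normrN. Qed.

End Projection.

(** * Gram-Schmidt with possible zero vectors *)

Section GramSchmidt.
Context {R : realType} {H : normedModType R} (inner : H -> H -> R).
Variable g : nat -> H.

Definition gs_residue (s : seq H) (h : H) : H := h - \sum_(e <- s) inner h e *: e.

Fixpoint gs_seq (n : nat) : seq H :=
  if n is n'.+1 then
    let r := gs_residue (gs_seq n') (g n') in rcons (gs_seq n') (`|r|^-1 *: r)
  else [::].

(* Orthonormal up to zero vectors: [gs n = 0] when [g n] depends on its
   predecessors (then the residue is [0], whose inverse norm is [0]). *)
Definition gs (n : nat) : H := last 0 (gs_seq n.+1).

Lemma gs_seqE n : gs_seq n = mkseq gs n.
Proof.
elim: n => //= n IH; rewrite mkseqS -IH; congr rcons.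
by rewrite /gs /= last_rcons.
Qed.

Let r n := g n - \sum_(i < n) inner (g n) (gs i) *: gs i.

Lemma gsE n : gs n = `|r n|^-1 *: r n.
Proof.
rewrite /gs /= last_rcons /gs_residue gs_seqE.
by rewrite big_map (_ : iota 0 n = index_iota 0 n) ?big_mkord// /index_iota subn0.
Qed.

Lemma gs_expand n : g n = `|r n| *: gs n + \sum_(i < n) inner (g n) (gs i) *: gs i.
Proof.
rewrite gsE scalerA; have [r0|r0] := eqVneq (r n) 0.
  by rewrite r0 scaler0 add0r; apply/eqP; rewrite -subr_eq0 -/(r n) r0.
by rewrite mulfV ?normr_eq0// scale1r subrK.
Qed.

Hypothesis ip : is_inner_product inner.

Lemma gs_norm n : gs n = 0 \/ inner (gs n) (gs n) = 1.
Proof.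
rewrite gsE; have [r0|r0] := eqVneq (r n) 0; first by left; rewrite r0 scaler0.
right; rewrite -(sqr_normE ip) normrZ normfV normr_id mulVf ?normr_eq0// expr1n.
by [].
Qed.

Lemma gs_orth i k : i != k -> inner (gs i) (gs k) = 0.
Proof.
wlog ik : i k / (k < i)%N.
  move=> h; rewrite neq_ltn => /orP[ik|ki]; last by apply: h => //; rewrite gtn_eqF.
  by rewrite (innerC ip); apply: h => //; rewrite gtn_eqF.
move=> _; elim/ltn_ind: i k ik => i IH k ki.
have IH' (a b : nat) : (a < i)%N -> (b < i)%N -> a != b -> inner (gs a) (gs b) = 0.
  move=> ai bi; rewrite neq_ltn => /orP[ab|ba]; last exact: IH.
  by rewrite (innerC ip); exact: IH.
rewrite gsE (innerZ ip) (innerD ip) (innerN ip) (inner_suml ip).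
rewrite (bigD1 (Ordinal ki))//= big1 ?addr0; last first.
  move=> a ak; rewrite (innerZ ip) IH' ?mulr0//.
rewrite (innerZ ip); case: (gs_norm k) => [->|->].
  by rewrite !(inner0r ip) mulr0 subrr mulr0.
by rewrite mulr1 subrr mulr0.
Qed.

Lemma gs_inner i k a : inner (a *: gs i) (gs k) *: gs k = (i == k)%:R *: (a *: gs i).
Proof.
rewrite (innerZ ip); have [->|ik] := eqVneq i k; last first.
  by rewrite gs_orth// mulr0 !scale0r.
case: (gs_norm k) => [->|->]; first by rewrite !scaler0.
by rewrite mulr1 scale1r.
Qed.

(** The vector [g m] is a combination of [gs 0, ..., gs m]. This is what makes late basis vectors
    orthogonal to families enumerated early. *)
Lemma inner_gs_later m i : (m < i)%N -> inner (gs i) (g m) = 0.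
Proof.
move=> mi; rewrite gs_expand (innerDr ip) (innerZr ip) gs_orth ?gtn_eqF// mulr0 add0r.
rewrite (innerC ip) (inner_suml ip) big1// => k _.
by rewrite (innerZ ip) gs_orth ?mulr0// ltn_eqF// (ltn_trans (ltn_ord k)).
Qed.

Definition gs_part n (h : H) : H := \sum_(i < n) inner h (gs i) *: gs i.

Lemma gs_partP a u v n : gs_part n (a *: u + v) = a *: gs_part n u + gs_part n v.
Proof.
rewrite /gs_part scaler_sumr -big_split/=; apply: eq_bigr => i _.
by rewrite (innerP ip) scalerDl scalerA.
Qed.

Lemma gs_part0 n : gs_part n 0 = 0.
Proof. by rewrite /gs_part big1// => i _; rewrite (inner0 ip) scale0r. Qed.

Lemma gs_part_gs n k a : (k < n)%N -> gs_part n (a *: gs k) = a *: gs k.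
Proof.
move=> kn; rewrite /gs_part (bigD1 (Ordinal kn))//= gs_inner eqxx scale1r.
rewrite big1 ?addr0// => i ik; rewrite gs_inner (_ : (k == i) = false) ?scale0r//.
by apply/negbTE; rewrite eq_sym.
Qed.

Lemma gs_part_sum n m (a : 'I_m -> R) : (m <= n)%N ->
  gs_part n (\sum_(i < m) a i *: gs i) = \sum_(i < m) a i *: gs i.
Proof.
move=> mn.
have pD u v : gs_part n (u + v) = gs_part n u + gs_part n v.
  by have := gs_partP 1 u v n; rewrite !scale1r.
rewrite (big_morph _ pD (gs_part0 n)); apply: eq_bigr => i _.
by rewrite gs_part_gs// (leq_trans (ltn_ord i)).
Qed.

Lemma gs_part_g n m : (m < n)%N -> gs_part n (g m) = g m.
Proof.
move=> mn; rewrite {1}gs_expand.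
rewrite -[X in gs_part n (X + _)]scale1r gs_partP scale1r gs_part_gs//.
by rewrite gs_part_sum ?(ltnW mn)// -gs_expand.
Qed.

Lemma inner_gs_part_gs n h i : (i < n)%N -> inner (gs_part n h) (gs i) = inner h (gs i).
Proof.
move=> ni; rewrite /gs_part (inner_suml ip) (bigD1 (Ordinal ni))//= big1 ?addr0.
  rewrite (innerZ ip); case: (gs_norm i) => [->|->]; last by rewrite mulr1.
  by rewrite !(inner0r ip) mulr0.
by move=> k ki; rewrite (innerZ ip) gs_orth ?mulr0.
Qed.

Lemma gs_part_orth n h : inner (h - gs_part n h) (gs_part n h) = 0.
Proof.
rewrite (innerC ip) {1}/gs_part (inner_suml ip) big1// => i _.
by rewrite (innerZ ip) (innerC ip (gs i)) (innerD ip) (innerN ip) inner_gs_part_gs//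
  subrr mulr0.
Qed.

Lemma gs_part_le n h : `|h - gs_part n h| <= `|h|.
Proof.
have := norm_pythagoras ip (gs_part_orth n h); rewrite subrK => e.
by rewrite -(@ler_pXn2r _ 2) ?nnegrE// e lerDl sqr_ge0.
Qed.

(** As soon as [k < n], the partial expansion fixes [g k]; the error at [h] is then the error at
    [h - g k], of norm at most [|h - g k|]. *)
Lemma gs_part_cvg (M : set H) h :
  (forall m e, M m -> 0 < e -> exists k, `|m - g k| < e) -> M h ->
  gs_part n h @[n --> \oo] --> h.
Proof.
move=> gd Mh; apply/cvgrPdist_lt => e e0; have [k hk] := gd _ _ Mh e0.
near=> n; apply: le_lt_trans hk.
have kn : (k < n)%N by near: n; exact: nbhs_infty_gt.
have -> : h - gs_part n h = (h - g k) - gs_part n (h - g k).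
  have -> : gs_part n (h - g k) = gs_part n h - g k.
    by rewrite addrC -scaleN1r gs_partP gs_part_g// scaleN1r addrC.
  by rewrite opprB addrA subrK.
exact: gs_part_le.
Unshelve. all: by end_near. Qed.

(** Pythagoras, with zero vectors included: where [gs i = 0], linearity gives [f (gs i) = 0], so
    both sides lose the term. *)
Lemma gs_sum_norm n (f : H -> R) :
  (forall a u v, f (a *: u + v) = a * f u + f v) ->
  `|\sum_(i < n) f (gs i) *: gs i| ^+ 2 = \sum_(i < n) f (gs i) ^+ 2.
Proof.
move=> fl; have f0 := linear_eq0 fl.
rewrite (sqr_normE ip) (inner_suml ip); apply: eq_bigr => i _.
rewrite (innerZ ip) (innerC ip) (inner_suml ip) (bigD1 i)//= big1 ?addr0; last first.
  by move=> k ki; rewrite (innerZ ip) gs_orth ?mulr0.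
rewrite (innerZ ip); case: (gs_norm i) => [->|->]; first by rewrite f0 !mul0r expr0n.
by rewrite mulr1 expr2.
Qed.

Lemma gs_sum_linear n (f : H -> R) (a : nat -> R) :
  (forall a u v, f (a *: u + v) = a * f u + f v) ->
  f (\sum_(i < n) a i *: gs i) = \sum_(i < n) a i * f (gs i).
Proof.
move=> fl.
have fD u v : f (u + v) = f u + f v by have := fl 1 u v; rewrite scale1r mul1r.
rewrite (big_morph _ fD (linear_eq0 fl)); apply: eq_bigr => i _.
by have := fl (a i) (gs i) 0; rewrite (linear_eq0 fl) !addr0.
Qed.

End GramSchmidt.

(** * Parseval's identity for the dual norm *)

Section DualNorm.
Context {R : realType} {H : completeNormedModType R} (inner : H -> H -> R).
Hypothesis ip : is_inner_product inner.
Variable M : set H.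
Hypothesis cM : closed_subspace M.
Variable g : nat -> H.
Hypothesis gM : forall n, M (g n).
Hypothesis gd : forall m e, M m -> 0 < e -> exists k, `|m - g k| < e.
Local Notation e := (gs inner g).
Local Notation Pr := (orth_proj inner M).

Lemma gs_in n : M (e n).
Proof.
elim/ltn_ind: n => n IH; rewrite gsE; apply: (subspaceZ cM).
apply: (subspaceB cM) => //; apply: (subspace_sum cM) => i.
by apply: (subspaceZ cM); exact: IH.
Qed.

Variables (f : H -> R) (K : R).
Hypothesis fl : forall a u v, f (a *: u + v) = a * f u + f v.
Hypothesis fK : forall u, f u <= K * `|u|.

Let fK' u : `|f u| <= K * `|u|.
Proof.
rewrite ler_norml fK andbT lerNl -mulN1r.
have := fl (-1) u 0; rewrite (linear_eq0 fl) !addr0 => <-.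
by rewrite scaleN1r (le_trans (fK _))// normrN.
Qed.

Let N := dual_norm (f \o Pr).

Lemma dual_norm_fin_num : N \is a fin_num.
Proof.
rewrite fin_real//; apply/andP; split.
  apply: (@lt_le_trans _ _ 0%E) => //; apply: ereal_sup_ubound.
  by exists 0; rewrite /= ?normr0// orth_proj_id ?(linear_eq0 fl) ?normr0//; case: cM.
apply: (@le_lt_trans _ _ `|K|%:E); last exact: ltry.
apply: ge_ereal_sup => _ [h h1 <-]; rewrite lee_fin /=.
rewrite (le_trans (fK' _))// (le_trans (ler_norm _))// normrM normr_id.
by rewrite ler_piMr// (le_trans (orth_proj_norm ip cM h)).
Qed.

Let A n := \sum_(i < n) f (e i) ^+ 2.

Let N_ge0 : 0 <= fine N.
Proof.
rewrite fine_ge0//; apply: ereal_sup_ubound.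
by exists 0; rewrite /= ?normr0// orth_proj_id ?(linear_eq0 fl) ?normr0//; case: cM.
Qed.

Let A_le n : A n <= fine N ^+ 2.
Proof.
have A0 : 0 <= A n by apply: sumr_ge0 => i _; exact: sqr_ge0.
(* The Riesz vector of [f] on the span of the first [n] basis vectors: [f w = |w|^2 = A n], so
   [w / |w|] tests the dual norm with value [sqrt (A n)]. *)
pose w := \sum_(i < n) f (e i) *: e i.
have Mw : M w by apply: (subspace_sum cM) => i; apply: (subspaceZ cM); exact: gs_in.
have fw : f w = A n.
  by rewrite /w (gs_sum_linear inner g n (fun i => f (e i)) fl); apply: eq_bigr => i _;
    rewrite expr2.
have nw : `|w| ^+ 2 = A n by exact: gs_sum_norm.
have [A1|A1] := leP (A n) 0; first by rewrite (le_trans A1)// sqr_ge0.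
have w0 : 0 < `|w| by rewrite lt_neqAle normr_ge0 andbT eq_sym;
  apply: contraTneq A1 => w0; rewrite -nw w0 expr0n ltxx.
have : (`|f (Pr (`|w|^-1 *: w))|%:E <= N)%E.
  apply: ereal_sup_ubound; exists (`|w|^-1 *: w) => //=.
  by rewrite normrZ normfV normr_id mulVf// gt_eqF.
rewrite orth_proj_id//; last exact: (subspaceZ cM).
rewrite -[N]fineK ?dual_norm_fin_num// lee_fin.
have := fl `|w|^-1 w 0; rewrite (linear_eq0 fl) !addr0 => ->.
rewrite fw -nw expr2 mulrA mulVf ?gt_eqF// mul1r normr_id => h.
by rewrite -expr2 lerXn2r ?nnegrE.
Qed.

(** The vector [w] of [A_le] gives one inequality. For the other, [f] is evaluated on partial
    expansions of [Pr h], Cauchy-Schwarz bounds it by [sqrt (A n)], and continuity of [f] passes to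
    the limit. *)
Lemma cvg_dual_norm : A n @[n --> \oo] --> fine N ^+ 2.
Proof.
have And : nondecreasing_seq A.
  apply/nondecreasing_seqP => n; rewrite /A big_ord_recr/= lerDl; exact: sqr_ge0.
have Aub : has_ubound (range A) by exists (fine N ^+ 2) => _ [n _ <-]; exact: A_le.
have cA := nondecreasing_cvgn And Aub.
suff -> : fine N ^+ 2 = sup (range A) by [].
apply/eqP; rewrite eq_le; apply/andP; split; last first.
  by apply: ge_sup; [exists (A 0%N), 0%N|move=> _ [n _ <-]; exact: A_le].
set L := sup _.
have L0 : 0 <= L.
  apply: le_trans (ub_le_sup Aub _); last by exists 0%N.
  by rewrite /A big_ord0.
have AL n : A n <= L by apply: ub_le_sup => //; exists n.
suff : fine N <= Num.sqrt L.
  move=> h; rewrite -[leRHS]sqr_sqrtr// lerXn2r ?nnegrE ?sqrtr_ge0//.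
rewrite -lee_fin fineK ?dual_norm_fin_num//.
apply: ge_ereal_sup => _ [h h1 <-]; rewrite lee_fin /=.
have MP := orth_proj_in ip cM h.
have cf : `|f (gs_part inner g n (Pr h))| @[n --> \oo] --> `|f (Pr h)|.
  apply: cvg_norm; have [_ fc] := @bounded_dual_elt R H f K fl fK.
  by apply: (cvg_comp _ f (gs_part_cvg ip gd MP)); exact: fc.
rewrite -(cvg_lim (@Rhausdorff R) cf); apply: limr_le; first by apply/cvg_ex;
  exists (`|f (Pr h)|).
apply: nearW => n; rewrite /gs_part (gs_sum_linear inner g n (fun i => inner (Pr h) (e
  i)) fl).
have -> : \sum_(i < n) inner (Pr h) (e i) * f (e i) =
    inner (\sum_(i < n) f (e i) *: e i) (Pr h).
  by rewrite (inner_suml ip); apply: eq_bigr => i _;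
    rewrite (innerZ ip) (innerC ip) mulrC.
rewrite (le_trans (cauchy_schwarz ip _ _))//.
rewrite (@le_trans _ _ `|\sum_(i < n) f (e i) *: e i|)//.
  by rewrite ler_piMr// (le_trans (orth_proj_norm ip cM h)).
rewrite -[leLHS]ger0_norm// -sqrtr_sqr ler_wsqrtr// (gs_sum_norm g ip n fl).
exact: AL.
Qed.

End DualNorm.

(** * A measurable norm is dominated by the Hilbert norm *)

Section NormBound.
Context {R : realType} {H : completeNormedModType R} (inner : H -> H -> R).
Hypothesis ip : is_inner_product inner.
Context {B : normedModType R} (j : H -> B).
Hypothesis jl : forall a u v, j (a *: u + v) = a *: j u + j v.

Let j0 : j 0 = 0.
Proof. by have := jl (-1) 0 0; rewrite scaler0 addr0 scaleN1r addNr. Qed.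

Let jZ a u : j (a *: u) = a *: j u.
Proof. by have := jl a u 0; rewrite j0 !addr0. Qed.

(** The interval of [t] with [|j (t e)| <= 1/2] has length [1 / |j e|], hence Gaussian mass at most
    [normal_peak 1 / |j e|]; by hypothesis this mass exceeds [1/2]. *)
Lemma gauss_prob_line_lt (e : H) :
  (gauss_prob [:: e] [set v | (2^-1 < `|j v|)%R] < 2^-1%:E)%E ->
  `|j e| <= 2 * normal_peak 1.
Proof.
have pk : 0 < normal_peak 1 :> R by apply: normal_peak_gt0; rewrite oner_neq0.
have [je0|je0] := eqVneq `|j e| 0; first by rewrite je0 mulr_ge0// ltW.
have K0 : 0 < `|j e| by rewrite lt_neqAle eq_sym je0 normr_ge0.
set K := `|j e| in K0 *; pose a := (2 * K)^-1.
have a0 : 0 < a by rewrite invr_gt0 mulr_gt0.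
pose I : set (measurableTypeR R) := [set` `[- a, a]].
have -> : gauss_prob [:: e] [set v | (2^-1 < `|j v|)%R] = normal_prob 0 1 (~` I).
  rewrite /gauss_prob /= /normal_prob [RHS]integral_mkcond; apply: eq_integral => t _.
  rewrite epatch_indic/= addr0; congr (_ * _%:E)%E; rewrite !indicE;
    congr (nat_of_bool _)%:R.
  have E : (2^-1 < `|j (t *: e)|) = ~~ (t \in `[- a, a]).
    rewrite in_itv/= -ler_norml -ltNge jZ normrZ -/K /a invfM ltr_pdivrMr//.
  apply/idP/idP.
    by rewrite !inE/= E => /negP.
  by rewrite !inE/= E => /negP.
have mI : measurable I by exact: measurable_itv.
rewrite probability_setC//.
have : (normal_prob 0 1 I <= (normal_peak 1 * (2 * a))%:E)%E.
  rewrite /normal_prob (@le_trans _ _ (\int[lebesgue_measure]_(x in I) (normal_peak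
    1)%:E)%E)//.
    apply: ge0_le_integral => //=.
    - by move=> x _; rewrite lee_fin normal_pdf_ge0.
    - by apply/measurable_EFinP/measurable_funTS; exact: measurable_normal_pdf.
    - by move=> x _; rewrite lee_fin normal_pdf_ub ?oner_neq0.
  rewrite integral_cst//= lebesgue_measure_itv/= lte_fin (_ : - a < a) ?gtrN//.
  by rewrite -EFinB -EFinM lee_fin opprK mulr_natl mulr2n.
have := fin_num_measure (normal_prob 0 1 : {measure set (measurableTypeR R) -> \bar R})
  I mI.
rewrite /=; case: (normal_prob 0 1 I) => // r _; rewrite lee_fin => h1.
rewrite -EFinB lte_fin => h2.
have : 2^-1 <= normal_peak 1 * (2 * a) by lra.
rewrite /a invfM mulVKf ?pnatr_eq0// ler_pdivlMr// => h3.
lra.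
Qed.

Let bounded_on (fs : seq H) := exists C, forall h,
  (forall f, f \in fs -> inner h f = 0) -> `|j h| <= C * `|h|.

(** Dropping one orthogonality condition adds at most one dimension, spanned by the projection [f']
    of [f] on the larger space. The component along [f'] costs [|j f'| / |f'|] in the constant. *)
Let bounded_on_behead f fs : bounded_on (f :: fs) -> bounded_on fs.
Proof.
move=> [C hC].
have cN := orth_closed_subspace ip fs.
set N := [set h | _] in cN.
pose f' := orth_proj inner N f.
have Nf' : N f' := orth_proj_in ip cN f.
have ff' h : N h -> inner h f = inner h f'.
  by move=> Nh; rewrite !(innerC ip h); exact: (inner_orth_proj ip cN).
have [f0|f0] := eqVneq f' 0.
  exists C => h Nh; apply: hC => f1; rewrite inE => /predU1P[->|]; last exact: Nh.
  by rewrite ff'// f0 (inner0r ip).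
have n2 : 0 < `|f'| by rewrite normr_gt0.
exists (`|C| + `|j f'| / `|f'|) => h Nh.
pose c := inner h f' / `|f'| ^+ 2.
pose u := h - c *: f'.
have Nu : N u by apply: (subspaceB cN) => //; exact: (subspaceZ cN).
have uf : inner u f' = 0.
  rewrite /u (innerD ip) (innerN ip) (innerZ ip) -(sqr_normE ip) /c divfK ?subrr//.
  by rewrite gt_eqF// exprn_gt0.
have ju : `|j u| <= C * `|u|.
  apply: hC => f1; rewrite inE => /predU1P[->|]; last exact: Nu.
  by rewrite ff'.
have uh : `|u| <= `|h|.
  have : `|u + c *: f'| ^+ 2 = `|u| ^+ 2 + `|c *: f'| ^+ 2.
    by apply: (norm_pythagoras ip); rewrite (innerZr ip) uf mulr0.
  rewrite subrK => e.
  by rewrite -(@ler_pXn2r _ 2) ?nnegrE// e lerDl sqr_ge0.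
have -> : j h = c *: j f' + j u by rewrite -jl addrC subrK.
rewrite (le_trans (ler_normD _ _))// mulrDl addrC lerD//.
  rewrite (le_trans ju)// (le_trans (ler_norm _))// normrM normr_id.
  by rewrite ler_wpM2l.
rewrite normrZ /c normrM normfV (ger0_norm (sqr_ge0 _)).
have := cauchy_schwarz ip h f' => cs.
rewrite (@le_trans _ _ (`|h| * `|f'| / `|f'| ^+ 2 * `|j f'|))//.
  by rewrite ler_wpM2r// ler_wpM2r// invr_ge0 sqr_ge0.
rewrite le_eqVlt; apply/orP; left; apply/eqP; field.
by rewrite normr_eq0.
Qed.

(** One-element orthonormal families already bound [j] on the orthogonal complement of the
    exceptional family; that family is then discarded one vector at a time. *)
Lemma measurable_norm_bounded : measurable_norm inner (fun h => `|j h|) ->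
  exists C, forall h, `|j h| <= C * `|h|.
Proof.
move=> mn; have half0 : 0 < 2^-1 :> R by [].
have [fs hfs] := mn _ half0.
have : bounded_on fs.
  exists (2 * normal_peak 1) => h hf.
  have [->|h0] := eqVneq h 0; first by rewrite j0 !normr0 mulr0.
  have nh : 0 < `|h| by rewrite normr_gt0.
  pose e := `|h|^-1 *: h.
  have : `|j e| <= 2 * normal_peak 1.
    apply: gauss_prob_line_lt; apply: hfs.
      move=> [|//] [|//] _ _ /=; rewrite -(sqr_normE ip) normrZ normfV normr_id.
      by rewrite mulVf ?gt_eqF// expr1n.
    move=> [|//] k _ ks /=; rewrite (innerZ ip) hf ?mulr0//.
    exact: mem_nth.
  by rewrite jZ normrZ normfV normr_id ler_pdivrMl// mulrC.
elim: fs {hfs} => [[C hC]|f fs IH /bounded_on_behead//].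
by exists C => h; exact: hC.
Qed.

End NormBound.

(** * Existence *)

Section RandomSeries.
Context {R : realType} {B : completeNormedModType R}.
Context (D : nat -> B).
Hypothesis denseD : forall b e, 0 < e -> exists n, `|b - D n| < e.

(** The same number bounds the size of the [k]-th increment and the probability that it is larger.
    It is written in the shape that [epsilon_trick0] sums. *)
Let ep (k : nat) : R := 1 / (2 ^ k.+1)%:R.

Let epS k : ep k = ep k.+1 * 2.
Proof.
rewrite /ep !natrX [in RHS]exprS invfM mulrA mulrAC.
by rewrite !mul1r mulVf ?pnatr_eq0// mul1r.
Qed.

Let ep_gt0 k : 0 < ep k.
Proof. by rewrite /ep divr_gt0// ltr0n expn_gt0. Qed.

Let cvg_ep : ep k @[k --> \oo] --> (0 : R).
Proof.
have -> : ep = (fun k => 2^-1 * 2^-1 ^+ k).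
  by apply/funext => k; rewrite /ep mul1r natrX -exprVn exprS.
rewrite -[X in _ --> X](mulr0 (2^-1 : R)); apply: cvgMr.
by apply: cvg_expr; rewrite ger0_norm//; lra.
Qed.

Lemma geometric_increments_cvg (u : nat -> B) n0 :
  (forall k, (n0 <= k)%N -> `|u k.+1 - u k| <= ep k) -> cvgn u.
Proof.
move=> h; apply: cauchy_seq_cvg => e e0.
(* The bound telescopes, since [ep k = 2 ep k - 2 ep (k+1)]. *)
have tel N n : (n0 <= N)%N -> `|u N - u (N + n)%N| <= 2 * ep N - 2 * ep (N + n)%N.
  move=> nN; elim: n => [|n IH]; first by rewrite addn0 !subrr normr0.
  rewrite addnS.
  have h1 := h (N + n)%N (leq_trans nN (leq_addr _ _)).
  have := ler_normD (u N - u (N + n)%N) (u (N + n)%N - u (N + n).+1).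
  rewrite addrA subrK (distrC (u (N + n)%N)) => h2.
  have := epS (N + n); lra.
have e2 : 0 < e / 2 by rewrite divr_gt0.
have /cvgr_lt/(_ _ e2)[N1 _ hN1] := cvg_ep.
exists (maxn N1 n0) => n Nn.
have -> : n = (maxn N1 n0 + (n - maxn N1 n0))%N by rewrite subnKC.
rewrite (le_lt_trans (tel _ _ (leq_maxr _ _)))//.
have := hN1 (maxn N1 n0) (leq_maxl _ _) => /=.
have := ep_gt0 (maxn N1 n0 + (n - maxn N1 n0)); lra.
Qed.

Lemma almost_sure_limit d (Om : measurableType d) (m : probability Om R)
    (T : nat -> Om -> B) :
  (forall k, measurable_fun setT (T k : Om -> borel B)) ->
  (forall k (r : R), measurable [set om | r < `|T k.+1 om - T k om|]) ->
  (forall k, m [set om | (ep k < `|T k.+1 om - T k om|)%R] <= (ep k)%:E)%E ->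
  exists S : Om -> B, measurable_fun setT (S : Om -> borel B) /\
  exists N : set Om, [/\ measurable N, m N = 0%E,
    forall om, ~ N om -> T ^~ om @ \oo --> S om &
    forall om, N om -> S om = 0].
Proof.
move=> mT mF PF.
pose F k := [set om | (ep k < `|T k.+1 om - T k om|)%R].
have mFk k : measurable (F k) by exact: mF.
have N0 : m (lim_sup_set F) = 0%E.
  apply: lim_sup_set_cvg0 => //.
  apply: (@le_lt_trans _ _ (\sum_(k <oo) (ep k)%:E)%E); last first.
    by apply: le_lt_trans (epsilon_trick0 _ _) _; rewrite ?ltry.
  by apply: lee_nneseries => // k _; exact: PF.
have mN : measurable (lim_sup_set F).
  by apply: bigcap_measurable => // k _; apply: bigcup_measurable.
have cT om : ~ lim_sup_set F om -> cvgn (T ^~ om).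
  move=> nF; have [n0 hn0] : exists n0, forall k, (n0 <= k)%N -> ~ F k om.
    apply: contrapT => h; apply: nF => n _.
    apply: contrapT => h2; apply: h; exists n => k nk Fk.
    by apply: h2; exists k.
  apply: (@geometric_increments_cvg _ n0) => k nk.
  by rewrite leNgt; apply/negP; exact: hn0.
(* The default [0] belongs to every subspace, so a support statement for the limit extends to the
   exceptional set. *)
pose S om := if `[< lim_sup_set F om >] then 0 else limn (T ^~ om).
have TS om : ~ lim_sup_set F om -> T ^~ om @ \oo --> S om.
  by move=> nF; rewrite /S asboolF//; exact: cT.
exists S; split; last first.
  exists (lim_sup_set F); split => // om Fom.
  by rewrite /S asboolT.
apply: (measurable_fun_borel_dual denseD) => x xd; have [xl xc] := xd.
(* Cutting the approximants off on the exceptional set makes them converge at every point. *)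
apply: (@measurable_fun_cvg _ Om R setT
  (fun k om => x (T k om) * \1_(~` lim_sup_set F) om)).
  move=> k; apply: measurable_funM; last by apply: measurable_indic; exact: measurableC.
  exact: (measurableT_comp (dual_elt_measurable xd) (mT k)).
move=> om _; rewrite /= indicE; have [Fom|Fom] := pselect (lim_sup_set F om).
  rewrite memNset; last by move=> /(_ Fom).
  rewrite /S asboolT// (linear_eq0 xl).
  by under eq_fun do rewrite mulr0; exact: cvg_cst.
rewrite mem_set//; under eq_fun do rewrite mulr1.
by apply: (cvg_comp _ x (TS _ Fom)); exact: xc.
Qed.

End RandomSeries.

Section Separability.
Context {R : realType}.

Lemma countable_dense_seq (V : normedModType R) (D : set V) :
  countable D -> closure D = setT ->
  exists d : nat -> V, forall v e, 0 < e -> exists n, `|v - d n| < e.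
Proof.
move=> /countable_injP[f fi] cD.
exists (fun n => xget 0 [set v | D v /\ f v = n]) => v e e0.
have : closure D v by rewrite cD.
move=> /(_ _ (nbhsx_ballx v e e0))[w [Dw]]; rewrite -ball_normE/= => vw.
exists (f w); suff -> : xget 0 [set v0 | D v0 /\ f v0 = f w] = w by [].
case: xgetP => [_ -> [Dy fy]|/(_ w)]; last by case.
by apply: fi => //; rewrite inE.
Qed.

Lemma dual_elt_bounded (V : normedModType R) (x : V -> R) : dual_elt x ->
  exists K, forall u, x u <= K * `|u|.
Proof.
move=> [xl xc]; have x0 := linear_eq0 xl.
have /cvgrPdist_lt/(_ 1 ltr01) := xc 0; rewrite x0.
move=> /nbhs_ballP[e /= e0 he]; exists (2 / e) => u.
have [->|u0] := eqVneq u 0; first by rewrite x0 normr0 mulr0.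
have nu : 0 < `|u| by rewrite normr_gt0.
have : ball (0 : V) e ((e / 2 / `|u|) *: u).
  rewrite -ball_normE/= sub0r normrN normrZ !normrM !normfV normr_id divfK ?gt_eqF//.
  by rewrite !ger0_norm ?ltW//; lra.
move=> /he; rewrite sub0r normrN => /(le_lt_trans (ler_norm _)).
have := xl (e / 2 / `|u|) u 0; rewrite x0 !addr0 => -> h.
rewrite -ler_pdivrMl ?divr_gt0// invf_div.
have : e / 2 / `|u| * x u * `|u| < 1 * `|u| by rewrite ltr_pM2r.
by rewrite mul1r (mulrAC _ (x u)) divfK ?gt_eqF// => /ltW.
Qed.

End Separability.

(** The first terms are zeroed and not dropped, so each later vector keeps its index and its own
    variable [coin_seq i]. *)
Definition tail_seq (V : zmodType) (m : nat) (v : nat -> V) (i : nat) : V :=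
  if (i < m)%N then 0 else v i.

(** * The centred Gaussian series *)

Section GaussianMeasure.
Context {R : realType} {H : completeNormedModType R} {inner : H -> H -> R}.
Context {B : completeNormedModType R} {j : H -> B} {M : set H}.
Hypothesis ip : is_inner_product inner.
Hypothesis cM : closed_subspace M.
Hypothesis jl : forall a u v, j (a *: u + v) = a *: j u + j v.
Hypothesis mnj : measurable_norm inner (fun h => `|j h|).
Local Notation Pr := (orth_proj inner M).
Local Notation P := (@coin_measure R).

Let ep (k : nat) : R := 1 / (2 ^ k.+1)%:R.

(** A basis vector [e] lies in [M], so [inner e f = inner e (Pr f)]. Here [Pr f] is some [g k] with
    [k < m], and Gram-Schmidt makes every [e] of index at least [m] orthogonal to it. *)
Lemma gauss_prob_orthonormal_tail (g : nat -> H) (fs : seq H) (eps : R) m n :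
  (forall k, M (g k)) ->
  (forall f, f \in fs -> exists2 k, (k < m)%N & Pr f = g k) ->
  (forall es : seq H, Defs.orthonormal inner es ->
    (forall i k, (i < size es)%N -> (k < size fs)%N ->
       inner (nth 0 es i) (nth 0 fs k) = 0) ->
    (gauss_prob es [set v | (eps < `|j v|)%R] < eps%:E)%E) ->
  (gauss_int (mkseq (tail_seq m (gs inner g)) n)
    (fun v => (\1_[set v | (eps < `|j v|)%R] v)%:E) < eps%:E)%E.
Proof.
move=> gM fg hes.
set e' := tail_seq _ _.
rewrite gauss_int_filter//.
have -> : [seq e <- mkseq e' n | e != 0] =
    map e' [seq i <- iota 0 n | e' i != 0] by rewrite filter_map.
set I := [seq i <- _ | _].
have uI : uniq I by rewrite filter_uniq// iota_uniq.
have Inz i : (i < size I)%N -> (m <= nth 0%N I i)%N /\ e' (nth 0%N I i) = gs inner g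
  (nth 0%N I i)
    /\ e' (nth 0%N I i) != 0.
  move=> iI; have := mem_nth 0%N iI; rewrite mem_filter => /andP[+ _].
  by rewrite /e' /tail_seq; case: ltnP; rewrite ?eqxx.
apply: hes.
  move=> i k; rewrite size_map => iI kI; rewrite !(nth_map 0%N)//.
  have [_ [-> inz]] := Inz _ iI; have [_ [-> _]] := Inz _ kI.
  have [->|ik] := eqVneq i k.
    case: (gs_norm g ip (nth 0%N I k)) => // e0.
    by have [_ [E /eqP]] := Inz _ kI; rewrite E e0.
  by apply: (gs_orth g ip); rewrite nth_uniq.
move=> i k; rewrite size_map => iI kf; rewrite (nth_map 0%N)//.
have [mi [-> _]] := Inz _ iI.
have [l lm Pl] := fg _ (mem_nth 0 kf).
rewrite (innerC ip) (inner_orth_proj ip cM); last exact: gs_in.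
rewrite Pl (innerC ip).
exact: (@inner_gs_later _ _ inner g ip l _ (leq_trans lm mi)).
Qed.

Context (d : nat -> H).
Hypothesis dense_d : forall h e, 0 < e -> exists n, `|h - d n| < e.
Context (fs : nat -> seq H).
Hypothesis fsP : forall k (es : seq H), Defs.orthonormal inner es ->
    (forall i l, (i < size es)%N -> (l < size (fs k))%N ->
       inner (nth 0 es i) (nth 0 (fs k) l) = 0) ->
    (gauss_prob es [set v | (ep k < `|j v|)%R] < (ep k)%:E)%E.

(** Through the coding of pairs, [(k, 0)] stands for the projection of [d k] and [(k, i+1)] for that
    of the [i]-th vector of [fs k]. The former give density in [M], the latter the control of
    tails. *)
Let g (n : nat) : H :=
  if (unpickle n : option (nat * nat)) is Some ki
  then Pr (nth 0 (d ki.1 :: fs ki.1) ki.2) else 0.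

Let gM n : M (g n).
Proof.
rewrite /g; case: unpickle => [ki|]; first exact: (orth_proj_in ip cM).
by case: cM.
Qed.

Let g_dense m e : M m -> 0 < e -> exists k, `|m - g k| < e.
Proof.
move=> Mm e0; have [n hn] := dense_d m e0.
exists (pickle (n, 0%N)); rewrite /g pickleK /=.
exact: le_lt_trans (orth_proj_dist ip cM (d n) Mm) hn.
Qed.

Let rank k := \max_(i < size (fs k)) (pickle (k, i.+1)).+1.

Let rankP k f : f \in fs k -> exists2 l, (l < rank k)%N & Pr f = g l.
Proof.
move=> /(nthP 0)[i ik <-]; exists (pickle (k, i.+1)); last by rewrite /g pickleK.
exact: (@leq_bigmax _ (fun i : 'I_(size (fs k)) => (pickle (k, i.+1)).+1) (Ordinal ik)).
Qed.

(** The ends of the blocks. The successor in the maximum makes them increase strictly, hence tend to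
    infinity; [rank] puts the start of block [k] beyond every code of a vector of [fs k]. *)
Fixpoint tail_index (k : nat) : nat :=
  if k is k'.+1 then maxn (tail_index k').+1 (rank k'.+1) else rank 0.

Let rank_le k : (rank k <= tail_index k)%N.
Proof. by case: k => //= k; rewrite leq_maxr. Qed.

Let tail_le k : (tail_index k <= tail_index k.+1)%N.
Proof. by rewrite /= (leq_trans (leqnSn _))// leq_maxl. Qed.

Let le_tail k : (k <= tail_index k)%N.
Proof. by elim: k => //= k IH; rewrite (leq_trans _ (leq_maxl _ _)). Qed.

Context (D : nat -> B).
Hypothesis denseD : forall b e, 0 < e -> exists n, `|b - D n| < e.

Let e := gs inner g.
Let T k : coins -> B := coin_sum (j \o e) (tail_index k).

Let j0 : j 0 = 0.
Proof. by have := jl (-1) 0 0; rewrite scaler0 addr0 scaleN1r addNr. Qed.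

Let TB k om : T k.+1 om - T k om =
  coin_sum (j \o (tail_seq (tail_index k) e)) (tail_index k.+1) om.
Proof.
rewrite /T /coin_sum; set n := tail_index k.+1; set m := tail_index k.
rewrite (big_ord_widen n (fun i => coin_seq i om *: (j \o e) i) (tail_le k)).
rewrite [X in _ - X]big_mkcond -sumrB; apply: eq_bigr => i _ /=.
by rewrite /tail_seq; case: ifP => _; rewrite ?subrr ?subr0// j0 scaler0.
Qed.

Let measurable_norm_gt (r : R) : measurable ([set b | r < `|b|] : set (borel B)).
Proof.
apply: sub_sigma_algebra.
have -> : [set b : B | r < `|b|] = Num.norm @^-1` `]r, +oo[.
  by apply/seteqP; split => b /=; rewrite in_itv/= andbT.
have /continuousP h := @norm_continuous R B.
by apply: h; exact: interval_open.
Qed.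

(** Along the blocks the cosine integrals converge to that of the limit by dominated convergence,
    and to the closed form by the computation for finite sums and Parseval. *)
Lemma gaussian_limit : exists S : coins -> B,
  [/\ measurable_fun setT (S : coins -> borel B),
      forall om, closure (j @` M) (S om) &
      forall (x : B -> R) s, dual_elt x ->
        dual_norm (restr_functional inner j M x) \is a fin_num /\
        (\int[P]_om (cos (s + x (S om)))%:E =
         (expR (- (fine (dual_norm (restr_functional inner j M x)) ^+ 2 / 2)) * cos
           s)%:E)%E].
Proof.
have mT k : measurable_fun setT (T k : coins -> borel B).
  exact: (measurable_coin_sum_borel denseD).
have mTB k (r : R) : measurable [set om | r < `|T k.+1 om - T k om|].
  under eq_set do rewrite TB.
  have := measurable_coin_sum_borel denseD
    (j \o (tail_seq (tail_index k) e)) (tail_index k.+1).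
  by move=> /(_ measurableT _ (measurable_norm_gt r)); rewrite setTI.
have PT k : (P [set om | (ep k < `|T k.+1 om - T k om|)%R] <= (ep k)%:E)%E.
  apply: ltW.
  have fg f : f \in fs k -> exists2 l, (l < tail_index k)%N & Pr f = g l.
    by move=> /rankP[l lr Pl]; exists l => //; exact: leq_trans (rank_le k).
  have := @gauss_prob_orthonormal_tail g (fs k) (ep k) (tail_index k) (tail_index k.+1)
    gM fg (fsP (k := k)).
  apply: le_lt_trans.
  (* Through this indicator the tail bound on [gauss_int] becomes the probability of a large
     increment. *)
  pose F (b : borel B) : \bar R := (\1_[set b : B | (ep k < `|b|)%R] b)%:E.
  have mF : measurable_fun setT F.
    by apply/measurable_EFinP; apply: measurable_indic; exact: measurable_norm_gt.
  have F0 b : (0 <= F b)%E by rewrite lee_fin.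
  have := @gauss_int_coin_sum R H B D denseD j F
    (tail_seq (tail_index k) e) (tail_index k.+1) 0 jl mF F0.
  under eq_integral do rewrite add0r.
  have -> : (fun h => F (0 + j h)) = (fun v => (\1_[set v | (ep k < `|j v|)%R] v)%:E).
    by apply/funext => v; rewrite add0r.
  move=> ->; rewrite le_eqVlt; apply/orP; left; apply/eqP.
  have -> : P [set om | (ep k < `|T k.+1 om - T k om|)%R] =
      (\int[P]_om (\1_[set om | (ep k < `|T k.+1 om - T k om|)%R] om)%:E)%E.
    by rewrite integral_indic// setIT.
  by apply: eq_integral => om _; rewrite /F -TB.
have [S [mS [N [mN N0 TS SN]]]] := almost_sure_limit denseD mT mTB PT.
have jM0 : (j @` M) 0 by exists 0 => //; case: cM.
exists S; split => //.
  move=> om; have [Nom|Nom] := pselect (N om).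
    by rewrite SN//; exact: subset_closure.
  apply: closed_cvg (TS _ Nom); first exact: closed_closure.
  apply: nearW => k; apply: subset_closure.
  exists (coin_sum e (tail_index k) om); last by rewrite (coin_sum_linear _ _ _ jl).
  by apply: (subspace_sum cM) => i; apply: (subspaceZ cM); exact: gs_in.
move=> x s xd; have [xl xc] := xd.
have [K xK] := dual_elt_bounded xd.
have [C jC] := measurable_norm_bounded ip jl mnj.
pose f := x \o j.
have fl a u v : f (a *: u + v) = a * f u + f v by rewrite /f /= jl xl.
have fK u : f u <= `|K| * `|C| * `|u|.
  rewrite (le_trans (xK _))// (@le_trans _ _ (`|K| * `|j u|))//.
    by rewrite ler_wpM2r// ler_norm.
  by rewrite -mulrA ler_wpM2l// (le_trans (jC u))// ler_wpM2r// ler_norm.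
have nfin := dual_norm_fin_num ip cM fl fK.
split; first exact: nfin.
set nrm := fine _.
have mcos (h : coins -> R) : measurable_fun setT h ->
    measurable_fun setT (fun om => (cos (s + h om))%:E).
  move=> mh; apply/measurable_EFinP; apply: (measurableT_comp (f := @cos R)).
    by apply: continuous_measurable_fun; exact: continuous_cos.
  exact: measurable_funD.
have mx (Y : coins -> borel B) : measurable_fun setT Y -> measurable_fun setT (x \o Y).
  by move=> mY; exact: (measurableT_comp (dual_elt_measurable xd) mY).
have cv1 : (\int[P]_om (cos (s + x (T k om)))%:E)%E @[k --> \oo] -->
    (\int[P]_om (cos (s + x (S om)))%:E)%E.
  have [//|||||] := @dominated_convergence _ coins R P setT measurableT
    (fun k om => (cos (s + x (T k om)))%:E) (fun om => (cos (s + x (S om)))%:E) (EFin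
      \o cst 1).
  - by move=> k; apply: mcos; exact: (mx (T k)).
  - by apply: mcos; exact: (mx S).
  - exists N; split => // om /= h; apply: contrapT => Nom; apply: h => _.
    apply: cvg_EFin; first exact: nearW.
    apply: (cvg_comp _ (@cos R)); last exact: continuous_cos.
    apply: cvgD; first exact: cvg_cst.
    by apply: (cvg_comp _ x (TS _ Nom)); exact: xc.
  - exact: finite_measure_integrable_cst.
  - by apply: aeW => om k _; rewrite /= lee_fin cos_max.
  by move=> _ _.
have cv2 : (\int[P]_om (cos (s + x (T k om)))%:E)%E @[k --> \oo] -->
    (expR (- (nrm ^+ 2 / 2)) * cos s)%:E.
  have -> : (fun k => \int[P]_om (cos (s + x (T k om)))%:E)%E =
      (fun k => (expR (- ((\sum_(i < tail_index k) f (e i) ^+ 2) / 2)) * cos s)%:E).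
    apply/funext => k; rewrite -(integral_coin_cos (fun i => f (e i))).
    by apply: eq_integral => om _; rewrite /T (@coin_sum_linear R B R^o x).
  apply: cvg_EFin; first exact: nearW.
  apply: cvgM; last exact: cvg_cst.
  apply: (cvg_comp _ (@expR R)); last exact: continuous_expR.
  apply: cvgN; apply: cvgM; last exact: cvg_cst.
  have /= cA := cvg_dual_norm ip cM gM g_dense fl fK.
  apply: (cvg_comp tail_index _ _ cA).
  apply/cvgnyPge => A; near=> k; apply: leq_trans (le_tail k).
  by near: k; exact: nbhs_infty_ge.
exact: (cvg_unique (@ereal_hausdorff R) cv1 cv2).
Unshelve. all: by end_near. Qed.

End GaussianMeasure.

Lemma dense_image (R : realType) (H B : normedModType R) (j : H -> B) (C : R)
    (d : nat -> H) :
  (forall a u v, j (a *: u + v) = a *: j u + j v) ->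
  (forall h, `|j h| <= C * `|h|) -> closure (range j) = setT ->
  (forall h e, 0 < e -> exists n, `|h - d n| < e) ->
  forall b e, 0 < e -> exists n, `|b - j (d n)| < e.
Proof.
move=> jl jC jd dd b e e0.
have e2 : 0 < e / 2 by rewrite divr_gt0.
have C1 : 0 < `|C| + 1 by rewrite ltr_wpDl.
have : closure (range j) b by rewrite jd.
move=> /(_ _ (nbhsx_ballx b _ e2))[_ [[h _ <-]]]; rewrite -ball_normE/= => bh.
have [n hn] := dd h _ (divr_gt0 e2 C1); exists n.
have jB : j h - j (d n) = j (h - d n).
  by rewrite (addrC h) -[- d n]scaleN1r jl scaleN1r addrC.
have := ler_normD (b - j h) (j h - j (d n)); rewrite addrA subrK => /le_lt_trans; apply.
rewrite (splitr e) ltrD// jB (le_lt_trans (jC _))//.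
apply: (@le_lt_trans _ _ ((`|C| + 1) * `|h - d n|)); last by rewrite mulrC -ltr_pdivlMr.
by rewrite ler_wpM2r// (le_trans (ler_norm C))// lerDl.
Qed.

Section ProbabilityOfMeasure.
Context d (T : measurableType d) (R : realType) (m : {measure set T -> \bar R}).
Hypothesis m1 : m setT = 1%E.

(** A fresh name for [m] that can carry the probability structure depending on [m1]. *)
Definition unit_mass : set T -> \bar R := m.
HB.instance Definition _ := Measure.on unit_mass.

Let unit_mass_setT : unit_mass setT = 1%E. Proof. exact: m1. Qed.
HB.instance Definition _ :=
  Measure_isProbability.Build _ _ _ unit_mass unit_mass_setT.

Lemma probability_of_measure :
  exists m' : probability T R, m = m' :> (set T -> \bar R).
Proof. by exists unit_mass. Qed.

End ProbabilityOfMeasure.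

Theorem theorem2p2 (R : realType) (H : completeNormedModType R)
    (inner : H -> H -> R) (B : completeNormedModType R) (j : H -> B)
    (M0 : set H) (p : H) :
  separable_Hilbert inner ->
  measurable_norm inner (fun h => `|j h|) ->
  completion_embedding j ->
  closed_subspace M0 ->
  (forall m, M0 m -> inner p m = 0) ->
  exists mu : {measure set (borel B) -> \bar R},
    [/\ char_functional_prop inner j M0 p mu,
        (forall nu : {measure set (borel B) -> \bar R},
           char_functional_prop inner j M0 p nu ->
           forall A : set (borel B), measurable A -> nu A = mu A)
      & mu (~` closure (j @` [set (p + m)%R | m in M0])) = 0%E].
Proof.
move=> [ip [D [cD clD]]] mn [jl ji jd] cM pM.
have [d dd] := countable_dense_seq cD clD.
have [C jC] := measurable_norm_bounded ip jl mn.
have Dd := dense_image jl jC jd dd.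
have ep0 k : 0 < 1 / (2 ^ k.+1)%:R :> R by rewrite divr_gt0// ltr0n expn_gt0.
have /choice[fs fsP] : forall k, exists fs : seq H, forall es : seq H, Defs.orthonormal
  inner es ->
    (forall i l, (i < size es)%N -> (l < size fs)%N ->
       inner (nth 0 es i) (nth 0 fs l) = 0) ->
    (gauss_prob es [set v | (1 / (2 ^ k.+1)%:R < `|j v|)%R] < (1 / (2 ^ k.+1)%:R)%:E)%E.
  by move=> k; exact: mn.
have [S [mS Scl Sx]] := gaussian_limit ip cM jl mn dd fsP Dd.
pose Y om : borel B := j p + S om.
have xD (x : B -> R) : dual_elt x -> forall u v, x (u + v) = x u + x v.
  by move=> [xl _] u v; have := xl 1 u v; rewrite scale1r mul1r.
have mY : measurable_fun setT Y.
  apply: (measurable_fun_borel_dual Dd) => x xd.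
  have -> : x \o Y = fun om => x (j p) + x (S om).
    by apply/funext => om /=; rewrite xD.
  apply: measurable_funD => //.
  exact: (measurableT_comp (dual_elt_measurable xd) mS).
pose mu := measure_function_pushforward__canonical__measure_function_Measure
  (@coin_measure R) mY.
have mu1 : mu setT = 1%E by exact: coin_measure_setT.
have mucos (x : B -> R) s : dual_elt x ->
    mu.-integrable setT (fun b : borel B => (cos (x b + s))%:E) /\
    (\int[mu]_b (cos (x b + s))%:E =
     (expR (- (fine (dual_norm (restr_functional inner j M0 x)) ^+ 2 / 2)) *
      cos (x (j p) + s))%:E)%E.
  move=> xd.
  have mc : measurable_fun setT (fun b : borel B => (cos (x b + s))%:E).
    apply/measurable_EFinP; apply: (measurableT_comp (f := @cos R)).
      by apply: continuous_measurable_fun; exact: continuous_cos.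
    by apply: measurable_funD => //; exact: dual_elt_measurable.
  have ic : (@coin_measure R).-integrable (Y @^-1` setT)
      ((fun b : borel B => (cos (x b + s))%:E) \o Y).
    rewrite preimage_setT.
    apply: (@probability_integrable_le1 _ _ _ (@coin_measure R) (fun om => cos (x (Y
      om) + s))).
      by apply/measurable_EFinP; exact: (measurableT_comp mc mY).
    by move=> om; exact: cos_max.
  split; first exact: integrable_pushforward.
  rewrite integral_pushforward// preimage_setT.
  rewrite -(Sx x (x (j p) + s) xd).2; apply: eq_integral => om _ /=.
  by rewrite /Y xD// addrAC.
have muchar : char_functional_prop inner j M0 p mu.
  move=> x xd n.
  (* The phase [0] gives the real part and [-pi/2] the imaginary part. *)
  have [c1 c2] := mucos x 0 xd; have [s1 s2] := mucos x (- (pi / 2)) xd.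
  have cs (y : R) : cos (y - pi / 2) = sin y by rewrite cosBpihalf.
  split.
  - by have [] := Sx x 0 xd.
  - by move: c1; under eq_fun do rewrite addr0.
  - by move: s1; under eq_fun do rewrite cs.
  - by move: c2; under eq_integral do rewrite addr0; rewrite addr0.
  - by move: s2; under eq_integral do rewrite cs; rewrite cs.
exists mu; split => //.
  move=> nu nuchar A mA.
  (* The cosine formula at the zero functional reads off the total mass of [nu], which makes it a
     probability. *)
  have nu1 : nu setT = 1%E.
    have [_ _ _ n4 _] := nuchar _ (@dual_elt0 R B).
    have [_ _ _ m4 _] := muchar _ (@dual_elt0 R B).
    have E (m : {measure set (borel B) -> \bar R}) :
      (\int[m]_b (cos 0)%:E = m setT)%E by rewrite cos0 integral_cst//= mul1e.
    by rewrite -E n4 -m4 E mu1.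
  have [mu' mu'E] := probability_of_measure mu1.
  have [nu' nu'E] := probability_of_measure nu1.
  rewrite mu'E nu'E.
  apply: (@char_functional_unique R B nu' mu' _ _ _ Dd) => // x xd.
    rewrite -mu'E -nu'E.
    by have [_ _ _ -> _] := nuchar _ xd; have [_ _ _ -> _] := muchar _ xd.
  rewrite -mu'E -nu'E.
  by have [_ _ _ _ ->] := nuchar _ xd; have [_ _ _ _ ->] := muchar _ xd.
(* Every value of [S] lies in the closure of [j M0], so every value of [Y] lies in its translate and
   the preimage is empty, not merely null. *)
rewrite /mu /= /pushforward (_ : Y @^-1` _ = set0) ?measure0//.
apply/seteqP; split => // om /=; apply.
move=> U nU.
have jpD : j p + b @[b --> S om] --> j p + S om.
  by apply: cvgD; [exact: cvg_cst|exact: cvg_id].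
have : nbhs (S om) [set b | U (j p + b)] by exact: jpD nU.
move=> /Scl[_ [[m Mm <-] Um]]; exists (j p + j m); split => //.
exists (p + m); first by exists m.
by have := jl 1 p m; rewrite !scale1r.
Qed.
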